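(* Let $G=(V,E)$ be a connected graph on $n$ vertices with a proper colouring $\omega$ from colour-set $C$, and let $U \subseteq V$ with $|U|=k$. Then, for any $d \in C$, $m_G(U,\omega,d)$ can be computed in time $O(n^{k+3}\cdot |E| \cdot |C|^2 \cdot 2^k)$.
   Context: Flood-filling game: a graph $G=(V,E)$ carries a colouring $\omega:V\to C$. A move $(v,d)$ with $v\in V$, $d\in C$ gives colour $d$ to every vertex of the monochromatic component of $v$ (the maximal connected set of vertices containing $v$ all having the same colour as $v$). Moves may be played at any vertex. For $A\subseteq V$, $m_G(A,\omega,d)$ denotes the minimum number of moves played in $G$ (starting from $\omega$) needed to create a monochromatic component of colour $d$ that contains every vertex of $A$. *)

(* Defs.v *)
From mathcomp Require Import all_boot.

Set Implicit Arguments.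
Unset Strict Implicit.
Unset Printing Implicit Defensive.

(** * Flood-filling

    A finite simple graph is a symmetric irreflexive relation on a finType. *)

Section Flood.
Variables (V C : finType) (e : rel V).

Definition edges : {set {set V}} :=
  [set [set p.1; p.2] | p : V * V & e p.1 p.2].

Definition connected_graph : Prop := 0 < #|V| /\ forall u v, connect e u v.

Implicit Types (w : {ffun V -> C}) (A : {set V}) (d : C).

Definition proper_colouring w : Prop := forall u v, e u v -> w u != w v.

(* The vertices reachable from v along edges with equally coloured ends. *)
Definition mono_component w (v : V) : {set V} :=
  [set u | connect [rel x y | e x y && (w x == w y)] v u].

Definition play_move w (vd : V * C) : {ffun V -> C} :=
  [ffun u => if u \in mono_component w vd.1 then vd.2 else w u].

Definition play w (s : seq (V * C)) : {ffun V -> C} := foldl play_move w s.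

(* There has to be a component of colour d even when A is empty. *)
Definition linked A w d : Prop :=
  exists v, w v = d /\ A \subset mono_component w v.

(* [min_moves A w d m] means m_G(A, w, d) = m. *)
Definition min_moves A w d (m : nat) : Prop :=
  (exists s, size s = m /\ linked A (play w s) d) /\
  (forall s, linked A (play w s) d -> m <= size s).

End Flood.

(** * Computation model

    A structured uniform-cost random access machine.  A program uses
    registers and an unbounded memory with indirect addressing, both holding
    natural numbers; the only arithmetic is addition and truncated
    subtraction.  There is no multiplication and there are no bit operations,
    so that unit cost is a reasonable measure. *)

Inductive expr :=
| Const of nat
| Reg of nat
| Fetch of expr
| Add of expr & expr
| Sub of expr & expr.

Inductive prog :=
| Skip
| Assign of nat & expr
| Store of expr & expr
| Seq of prog & prog
| If of expr & prog & prog
| While of expr & prog.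

Record state := State { reg : nat -> nat; cell : nat -> nat }.

Fixpoint eval (s : state) (a : expr) : nat :=
  match a with
  | Const n => n
  | Reg x => reg s x
  | Fetch b => cell s (eval s b)
  | Add b c => eval s b + eval s c
  | Sub b c => eval s b - eval s c
  end.

Fixpoint cost (a : expr) : nat :=
  match a with
  | Const _ | Reg _ => 1
  | Fetch b => (cost b).+1
  | Add b c | Sub b c => (cost b + cost c).+1
  end.

Definition set_reg (s : state) x n := State [eta reg s with x |-> n] (cell s).
Definition set_mem (s : state) i n := State (reg s) [eta cell s with i |-> n].

(* [exec p s t s']: started in s, the program p halts in s' after t steps.
   A test succeeds when its value is nonzero. *)
Inductive exec : prog -> state -> nat -> state -> Prop :=
| ExecSkip s : exec Skip s 1 s
| ExecAssign s x a :
    exec (Assign x a) s (cost a).+1 (set_reg s x (eval s a))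
| ExecStore s a b :
    exec (Store a b) s (cost a + cost b).+1 (set_mem s (eval s a) (eval s b))
| ExecSeq p q s1 t1 s2 t2 s3 :
    exec p s1 t1 s2 -> exec q s2 t2 s3 -> exec (Seq p q) s1 (t1 + t2) s3
| ExecIfTrue a p q s t s' :
    eval s a != 0 -> exec p s t s' -> exec (If a p q) s (cost a + t).+1 s'
| ExecIfFalse a p q s t s' :
    eval s a = 0 -> exec q s t s' -> exec (If a p q) s (cost a + t).+1 s'
| ExecWhileDone a p s :
    eval s a = 0 -> exec (While a p) s (cost a).+1 s
| ExecWhileLoop a p s1 t1 s2 t2 s3 :
    eval s1 a != 0 -> exec p s1 t1 s2 -> exec (While a p) s2 t2 s3 ->
    exec (While a p) s1 (cost a + t1 + t2).+1 s3.

(* The input occupies the first memory cells, everything else is 0; the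
   output is read in register 0. *)
Definition computes_within (p : prog) (input : seq nat) (out time : nat) :=
  exists t s, [/\ exec p (State (fun=> 0) (nth 0 input)) t s,
                  reg s 0 = out & t <= time].

(** Encoding of an instance: vertices and colours are numbered from 0, and the
    memory holds |V|, |C|, |U|, the target colour, the colour of each vertex,
    the list of the elements of U, and the adjacency matrix row by row. *)

Definition rank (T : finType) (x : T) : nat := enum_rank x.

Definition encode (V C : finType) (e : rel V) (w : {ffun V -> C})
    (U : {set V}) (d : C) : seq nat :=
  [:: #|V|; #|C|; #|U|; rank d]
    ++ [seq rank (w v) | v <- enum V]
    ++ [seq rank v | v <- enum U]
    ++ [seq nat_of_bool (e u v) | u <- enum V, v <- enum V].

(* Main.v *)
Require Import Defs.
From mathcomp Require Import all_boot zify.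

(** Call a set of monochromatic components derivable in colour [d] at cost [c]
    if it is a single component of colour [d] and [c = 0], or if it is derivable
    in another colour at cost [c - 1], or if it is the union of two sets joined
    by an edge, both derivable in colour [d], with costs adding up to [c].  Then
    m(U, w, d) is the least cost of a derivable set covering [U].

    In a derivation a repeated leaf can always be removed at no cost
    ([deriv_overlap]), so every component may be assumed to occur only once.
    Hence an innermost recolouring can be played as an actual move without
    disturbing the other leaves, which lowers the cost by one; conversely the
    component created by a move occurs only once in a derivation for the
    position after that move, and undoing the move costs at most one recolouring.

    For a proper colouring the components are vertices.  To compute the least
    cost it is enough to know, for all [k]-tuples [t] of vertices and all colours
    [d], the least cost T(t, d) of a set containing [t]: a set joined from two
    parts along an edge [x y] splits [t] into the positions in the first part,
    the others being replaced by [x], and the remaining ones, the others being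
    replaced by [y].  A derivation with [N] leaves and cost [c] is accounted for
    after [N + c] rounds of relaxing all these inequalities, and both [N] and
    [c] may be taken to be at most [n]. *)

Set Implicit Arguments.
Unset Strict Implicit.
Unset Printing Implicit Defensive.

(** * Derivations *)

(** The first edge of a path that leaves [A] will do; that [b] is still reachable from [x] lets
    callers place it in the same monochromatic component. *)
Lemma connect_escape (T : finType) (r : rel T) (A : {set T}) x z :
  connect r x z -> x \in A -> z \notin A ->
  exists a b, [/\ a \in A, b \notin A, r a b & connect r x b].
Proof.
move=> /connectP [p]; elim: p x => [|y p IHp] x /=.
  by move=> _ -> ->.
case/andP=> rxy yp lastp xA zA.
case yA: (y \in A); last by exists x, y; rewrite xA yA rxy connect1.
have [a [b [aA bA rab yb]]] := IHp y yp lastp yA zA.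
by exists a, b; rewrite aA bA rab (connect_trans (connect1 rxy)).
Qed.

Section Derivations.
Variables (V C : finType) (e : rel V).
Hypothesis sym_e : symmetric e.
Implicit Types (w : {ffun V -> C}) (X Y : {set {set V}}) (A : {set V}).

Local Notation mc := (mono_component e).
Local Notation step w := [rel x y | e x y && (w x == w y)].

Lemma step_connect_sym w : connect_sym (step w).
Proof. by apply: sym_connect_sym => x y /=; rewrite sym_e eq_sym. Qed.

Lemma mono_component_refl w v : v \in mc w v.
Proof. by rewrite inE connect0. Qed.

Lemma eq_mono_component w v u : u \in mc w v -> mc w u = mc w v.
Proof.
rewrite inE => vu; apply/setP=> x; rewrite !inE.
by rewrite (same_connect (step_connect_sym w) vu).
Qed.

Lemma mono_component_eq w v u : mc w u = mc w v -> u \in mc w v.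
Proof. by move=> <-; apply: mono_component_refl. Qed.

Lemma mono_component_colour w v u : u \in mc w v -> w u = w v.
Proof.
rewrite inE => /connectP [p]; elim: p v => [|y p IHp] v /= => [_ -> //|].
by case/andP=> /andP [_ /eqP ->] yp /(IHp _ yp).
Qed.

Lemma mono_component_step w v x y :
  x \in mc w v -> e x y -> w x = w y -> y \in mc w v.
Proof.
rewrite !inE => vx exy wxy; apply: connect_trans vx (connect1 _).
by rewrite /= exy wxy eqxx.
Qed.

(* [deriv w X d N c]: the components in [X] can be united in colour [d] at cost
   [c], through a tree of [N] leaves in which a component may occur repeatedly. *)
Inductive deriv w : {set {set V}} -> C -> nat -> nat -> Prop :=
| DLeaf v : deriv w [set mc w v] (w v) 1 0
| DRecolour X a d N c : deriv w X a N c -> deriv w X d N c.+1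
| DMerge X Y d N1 N2 c1 c2 x y :
    deriv w X d N1 c1 -> deriv w Y d N2 c2 ->
    x \in cover X -> y \in cover Y -> e x y ->
    deriv w (X :|: Y) d (N1 + N2) (c1 + c2).

Lemma coverU X Y : cover (X :|: Y) = cover X :|: cover Y.
Proof. by rewrite /cover bigcup_setU. Qed.

Lemma deriv_leaves w X d N c : deriv w X d N c -> #|X| <= N /\ 0 < N.
Proof.
elim=> {X d N c} [v||X Y d N1 N2 c1 c2 x y _ [X1 N1p] _ [Y1 _] _ _ _] //.
  by rewrite cards1.
split; last by rewrite addn_gt0 N1p.
by apply: leq_trans (leq_add X1 Y1); rewrite cardsU leq_subr.
Qed.

Lemma deriv_component w X d N c K :
  deriv w X d N c -> K \in X -> exists v, K = mc w v.
Proof.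
elim=> {X d N c} [v||X Y d N1 N2 c1 c2 x y _ IHX _ IHY _ _ _] //.
  by move/set1P->; exists v.
by case/setUP.
Qed.

Lemma card_deriv w X d N c : deriv w X d N c -> #|X| <= #|V|.
Proof.
move=> dX; rewrite -cardsT.
apply: leq_trans (leq_imset_card (mc w) _); apply/subset_leq_card/subsetP=> K.
by case/(deriv_component dX)=> v ->; apply: imset_f.
Qed.

(** The derivation of [Y] ends in the colour that the leaf [mc w v] starts with, so it can be
    grafted in place of one such leaf in the tree of [X]. Covers only grow, hence the joining edges
    remain valid. *)
Lemma deriv_subst w X Y d N1 N2 c1 c2 v :
  deriv w X d N1 c1 -> mc w v \in X ->
  deriv w Y (w v) N2 c2 -> mc w v \in Y ->
  deriv w (X :|: Y) d (N1 + N2).-1 (c1 + c2).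
Proof.
move=> dX vX dY vY; elim: dX vX => {X d N1 c1}.
- move=> u /set1P vu; rewrite (mono_component_colour (mono_component_eq vu)) in dY.
  by rewrite -vu (setUidPr _) ?sub1set.
- by move=> X a d N c _ IH /IH; rewrite addSn; apply: DRecolour.
move=> X1 X2 d N1 N1' c1 c1' x y d1 IH1 d2 IH2 x1 y2 exy.
have [_ N1p] := deriv_leaves d1; have [_ N2p] := deriv_leaves d2.
case/setUP=> [/IH1|/IH2] dXY.
  have -> : (N1 + N1' + N2).-1 = (N1 + N2).-1 + N1'.
    by rewrite addnAC -(prednK N1p).
  rewrite setUAC [c1 + _ + _]addnAC; apply: DMerge dXY d2 _ y2 exy.
  by rewrite coverU inE x1.
have -> : (N1 + N1' + N2).-1 = N1 + (N1' + N2).-1.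
  by rewrite -addnA -(prednK N2p) addSn addnS.
rewrite -setUA -[c1 + _ + _]addnA; apply: DMerge d1 dXY x1 _ exy.
by rewrite coverU inE y2.
Qed.

(* Follow the shared component through the derivation of [X]: its last
   recolouring, to [d], is replaced by one back to its original colour, where
   the derivation of [Y] takes over. *)
Lemma deriv_overlap w X Y d N1 N2 c1 c2 K :
  deriv w X d N1 c1 -> K \in X -> deriv w Y d N2 c2 -> K \in Y ->
  deriv w (X :|: Y) d (N1 + N2).-1 (c1 + c2).
Proof.
move=> dX; have [_ N1p] := deriv_leaves dX.
elim: dX Y N2 c2 => {X d N1 c1 N1p}.
- by move=> v Y N2 c2 /set1P -> dY vY; rewrite (setUidPr _) ?sub1set.
- move=> X a d N c dX _ Y N2 c2 KX dY KY; rewrite setUC [N + _]addnC [c.+1 + _]addnC.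
  case: (deriv_component dX KX) => v vK; rewrite vK in KX KY.
  exact: deriv_subst dY KY (DRecolour (w v) dX) KX.
move=> X1 X2 d N1 N1' c1 c1' x y d1 IH1 d2 IH2 x1 y2 exy Y N2 c2 KX dY KY.
have [_ N1p] := deriv_leaves d1; have [_ N2p] := deriv_leaves d2.
case/setUP: KX => [K1|K2].
  have dXY := IH1 _ _ _ K1 dY KY.
  have -> : (N1 + N1' + N2).-1 = (N1 + N2).-1 + N1'.
    by rewrite addnAC -(prednK N1p).
  rewrite setUAC [c1 + _ + _]addnAC; apply: DMerge dXY d2 _ y2 exy.
  by rewrite coverU inE x1.
have dXY := IH2 _ _ _ K2 dY KY.
have -> : (N1 + N1' + N2).-1 = N1 + (N1' + N2).-1.
  by rewrite -addnA -(prednK N2p) addSn addnS.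
rewrite -setUA -[c1 + _ + _]addnA; apply: DMerge d1 dXY x1 _ exy.
by rewrite coverU inE y2.
Qed.

Lemma deriv_shrink w X d N c :
  deriv w X d N c -> #|X| < N -> exists2 N', N' < N & deriv w X d N' c.
Proof.
elim=> {X d N c}.
- by move=> v; rewrite cards1.
- by move=> X a d N c _ IH /IH [N' ltN dX]; exists N' => //; apply: DRecolour dX.
move=> X Y d N1 N2 c1 c2 x y dX IHX dY IHY xX yY exy ltXY.
have [leX X0] := deriv_leaves dX; have [leY _] := deriv_leaves dY.
case: (ltnP #|X| N1) => [/IHX [N' ltN dX']|geX].
  by exists (N' + N2); [rewrite ltn_add2r | apply: DMerge dX' dY xX yY exy].
case: (ltnP #|Y| N2) => [/IHY [N' ltN dY']|geY].
  by exists (N1 + N'); [rewrite ltn_add2l | apply: DMerge dX dY' xX yY exy].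
have [K] : exists K, K \in X :&: Y.
  apply/set0Pn; apply: contraTneq ltXY => XY0.
  by rewrite -leqNgt cardsU XY0 cards0 subn0 leq_add.
case/setIP=> KX KY; exists (N1 + N2).-1; last exact: deriv_overlap dX KX dY KY.
by rewrite prednK // addn_gt0 X0.
Qed.

Lemma deriv_uniq w X d N c : deriv w X d N c -> deriv w X d #|X| c.
Proof.
have [n] := ubnP N; elim: n N => // n IHn N ltN dX.
have [leX _] := deriv_leaves dX.
case: (ltnP #|X| N) => [/(deriv_shrink dX) [N' ltN' dX']|geX].
  by apply: IHn dX'; apply: leq_trans ltN' _.
by rewrite -(@anti_leq N #|X|) // geX.
Qed.

(** Counting: [N1 + N2] is at least [#|X| + #|Y|], which the union attains only if the parts are
    disjoint. Inductions on repetition-free derivations can thus descend into both parts of a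
    merge. *)
Lemma deriv_split_uniq w X Y d N1 N2 c1 c2 :
  deriv w X d N1 c1 -> deriv w Y d N2 c2 -> N1 + N2 = #|X :|: Y| ->
  [/\ N1 = #|X|, N2 = #|Y| & forall K, K \in X -> K \in Y -> false].
Proof.
move=> /deriv_leaves [leX _] /deriv_leaves [leY _]; rewrite cardsU => eqN.
have XY0 : #|X :&: Y| = 0.
  by have := subset_leq_card (subsetIl X Y); have := subset_leq_card (subsetIr X Y); lia.
split; [lia | lia |] => K KX KY; move/eqP: XY0; rewrite cards_eq0.
by move/eqP/setP/(_ K); rewrite !inE KX KY.
Qed.

(** Without recolouring, a merge joins equally coloured components along an edge, and such
    components coincide. *)
Lemma deriv_free w X d N c :
  deriv w X d N c -> c = 0 -> exists2 v, X = [set mc w v] & w v = d.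
Proof.
elim=> {X d N c} [v _|//|X Y d N1 N2 c1 c2 x y _ IHX _ IHY xX yY exy /eqP].
  by exists v.
rewrite addn_eq0 => /andP [/eqP /IHX [v Xv vd] /eqP /IHY [u Yu ud]].
exists v => //; rewrite Xv Yu (_ : mc w u = mc w v) ?setUid //.
rewrite Xv cover1 in xX; rewrite Yu cover1 in yY.
rewrite -(eq_mono_component yY); apply: eq_mono_component.
apply: (mono_component_step xX exy).
by rewrite (mono_component_colour xX) (mono_component_colour yY) vd ud.
Qed.

(** Applied with [w] the colouring after a move and [K] a component before it; the union is then the
    single new component containing [K]. *)
Definition grow w (K : {set V}) : {set V} := \bigcup_(u in K) mc w u.

(** * The effect of a single move on derivations *)

Section Move.
Variables (w : {ffun V -> C}) (v : V) (b : C).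
Let w' := play_move e w (v, b).

Lemma move_in u : u \in mc w v -> w' u = b.
Proof. by move=> uv; rewrite ffunE /= uv. Qed.

Lemma move_out u : u \notin mc w v -> w' u = w u.
Proof. by move=> uv; rewrite ffunE /= (negPf uv). Qed.

(** Adjacent vertices of equal colour are both inside or both outside the recoloured component, so
    they still agree after the move. *)
Lemma move_component u : mc w u \subset mc w' u.
Proof.
apply/subsetP=> z; rewrite !inE; apply: connect_sub => x y /= /andP [exy /eqP wxy].
apply: connect1; rewrite /= exy /=.
have eqxy : (x \in mc w v) = (y \in mc w v).
  by apply/idP/idP=> /mono_component_step; [apply | rewrite sym_e in exy; apply].
by rewrite !ffunE /= eqxy wxy.
Qed.

Lemma grow_component u : grow w' (mc w u) = mc w' u.
Proof.
apply/eqP; rewrite eqEsubset; apply/andP; split.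
  apply/bigcupsP=> z zu; rewrite (@eq_mono_component w' u z) //.
  exact: (subsetP (move_component u)).
by apply/bigcup_sup/mono_component_refl.
Qed.

Lemma cover_grow X : cover X \subset cover (grow w' @: X).
Proof.
apply/subsetP=> z /bigcupP [K KX zK]; apply/bigcupP; exists (grow w' K).
  exact: imset_f.
by apply/bigcupP; exists z => //; apply: mono_component_refl.
Qed.

Lemma deriv_move_away X d N c :
  deriv w X d N c -> mc w v \notin X -> deriv w' (grow w' @: X) d N c.
Proof.
elim=> {X d N c}.
- move=> u; rewrite inE imset_set1 grow_component => neq.
  rewrite -(@move_out u); first exact: DLeaf.
  by apply: contra neq => /eq_mono_component ->.
- by move=> X a d N c _ IH /IH; apply: DRecolour.
move=> X Y d N1 N2 c1 c2 x y _ IHX _ IHY xX yY exy.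
rewrite inE negb_or imsetU => /andP [/IHX dX /IHY dY].
by apply: DMerge dX dY _ _ exy; apply: (subsetP (cover_grow _)).
Qed.

(** One recolouring gives [mc w v] the colour [b]; the rest of the new component consists of old
    components of colour [b], attached one by one at no cost. *)
Lemma deriv_star :
  exists X N, deriv w X b N 1 /\ mc w' v \subset cover X.
Proof.
suff aux n X N : deriv w X b N 1 -> mc w v \in X ->
    #|mc w' v :\: cover X| < n ->
    exists Y M, deriv w Y b M 1 /\ mc w' v \subset cover Y.
  exact: aux (DRecolour b (DLeaf w v)) (set11 _) (ltnSn _).
elim: n X N => // n IHn X N dX vX ltn.
have [sub|/subsetPn [z zv zX]] := boolP (mc w' v \subset cover X).
  by exists X, N.
have vC : mc w v \subset cover X by apply: (bigcup_sup (mc w v)).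
rewrite inE in zv.
have [|x [y [xX yX /andP [exy /eqP wxy] vy]]] := connect_escape zv _ zX.
  by apply: (subsetP vC); apply: mono_component_refl.
have wy : w y = b.
  rewrite -(@move_out y); last by apply: contra yX => /(subsetP vC).
  rewrite -(@move_in v) ?mono_component_refl //.
  by apply: (@mono_component_colour w'); rewrite inE.
have dY : deriv w (X :|: [set mc w y]) b (N + 1) 1.
  have dy := DLeaf w y; rewrite wy in dy.
  have := DMerge dX dy xX _ exy; rewrite addn0; apply.
  by rewrite cover1 mono_component_refl.
apply: IHn dY _ _; first by rewrite inE vX.
rewrite -ltnS; apply: leq_trans ltn; rewrite ltnS; apply: proper_card.
apply/properP; split.
  by apply: setDS; rewrite coverU subsetUl.
exists y; first by rewrite !inE yX vy.
by rewrite inE coverU inE cover1 mono_component_refl orbT.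
Qed.

(* The only leaf to be rebuilt is the component of [v], which occurs at most once. *)
Lemma deriv_unmove X d N c :
  deriv w' X d N c -> N = #|X| ->
  exists Y N' c', [/\ deriv w Y d N' c', cover X \subset cover Y
                    & c' <= c + (mc w' v \in X)].
Proof.
elim=> {X d N c}.
- move=> u _; rewrite cover1 inE; case: eqP => [eqv|neq].
    have [Y [N [dY sub]]] := deriv_star.
    exists Y, N, 1; rewrite -eqv; split=> //.
    rewrite -(mono_component_colour (mono_component_eq eqv)).
    by rewrite move_in ?mono_component_refl.
  exists [set mc w u], 1, 0; split=> //.
    rewrite move_out; first exact: DLeaf.
    by apply/negP=> /(subsetP (move_component v)) /eq_mono_component; move/esym.
  (* This component is unchanged by the move: an edge on which [mc w' u] leaves [mc w u] would have
     both ends untouched, hence equally coloured before the move. *)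
  rewrite cover1; apply/subsetP=> z; rewrite inE => uz.
  case zu: (z \in mc w u) => //.
  have [||x [y [xu yu /andP [exy /eqP wxy] uy]]] := connect_escape uz (A := mc w u).
  + exact: mono_component_refl.
  + by rewrite zu.
  have out t : t \in mc w' u -> t \notin mc w v.
    move=> tu; apply/negP=> /(subsetP (move_component v)) tv.
    by apply: neq; rewrite -(eq_mono_component tv) -(eq_mono_component tu).
  case/negP: yu; apply: (mono_component_step xu exy).
  rewrite -(@move_out x) ?wxy ?move_out //; apply: out; first by rewrite inE.
  exact: (subsetP (move_component u)).
- move=> X a d N c _ IH /IH [Y [N' [c' [dY sub lec]]]].
  by exists Y, N', c'.+1; split=> //; apply: DRecolour dY.
move=> X1 X2 d N1 N2 c1 c2 x y d1 IH1 d2 IH2 x1 y2 exy eqN.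
have [eqN1 eqN2 disj] := deriv_split_uniq d1 d2 eqN.
have [Y1 [N1' [c1' [dY1 sub1 le1]]]] := IH1 eqN1.
have [Y2 [N2' [c2' [dY2 sub2 le2]]]] := IH2 eqN2.
exists (Y1 :|: Y2), (N1' + N2'), (c1' + c2'); split.
- by apply: DMerge dY1 dY2 _ _ exy; [apply: (subsetP sub1) | apply: (subsetP sub2)].
- by rewrite !coverU setUSS.
(* By disjointness the new component lies in at most one part, so the extra recolouring is charged
   once. *)
have := disj (mc w' v); rewrite inE.
by move: le1 le2; case: (_ \in X1); case: (_ \in X2) => /= ? ? H; [have := H isT isT | | |]; lia.
Qed.

End Move.

(* The component of an innermost recolouring occurs nowhere else, so that moving
   there leaves the rest of the derivation intact. *)
Lemma deriv_first_move w X d N c :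
  deriv w X d N c -> N = #|X| -> 0 < c ->
  exists v b (w' := play_move e w (v, b)),
    mc w v \in X /\ deriv w' (grow w' @: X) d N c.-1.
Proof.
elim=> {X d N c} [//|X a d N c dX IH eqN _|].
  (* With no recolouring below, this one is innermost and [X] is a single component, which becomes a
     leaf once the move is played. *)
  case: c => [|c] in dX IH *.
    have [v Xv _] := deriv_free dX erefl; rewrite Xv.
    exists v, d; split; first exact: set11.
    rewrite imset_set1 grow_component eqN Xv cards1.
    have := DLeaf (play_move e w (v, d)) v.
    by rewrite move_in ?mono_component_refl.
  have [v [b [vX dX']]] := IH eqN isT.
  by exists v, b; split=> //; apply: DRecolour dX'.
move=> X1 X2 d N1 N2 c1 c2 x y d1 IH1 d2 IH2 x1 y2 exy eqN c_gt0.
have [eqN1 eqN2 disj] := deriv_split_uniq d1 d2 eqN.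
have [c10|c1_gt0] := posnP c1.
  have [|v [b [v2 d2']]] := IH2 eqN2; first by rewrite c10 in c_gt0.
  exists v, b; split; first by rewrite inE v2 orbT.
  rewrite /= imsetU c10 add0n -[c2.-1]add0n.
  have d1' := deriv_move_away b d1 (introN idP (fun v1 => notF (disj _ v1 v2))).
  rewrite c10 in d1'.
  by apply: DMerge d1' d2' _ _ exy; apply: (subsetP (cover_grow _ _ _ _)).
have [v [b [v1 d1']]] := IH1 eqN1 c1_gt0.
exists v, b; split; first by rewrite inE v1.
rewrite /= imsetU (_ : (c1 + c2).-1 = c1.-1 + c2); last by case: (c1) c1_gt0.
have d2' := deriv_move_away b d2 (introN idP (fun v2 => notF (disj _ v1 v2))).
by apply: DMerge d1' d2' _ _ exy; apply: (subsetP (cover_grow _ _ _ _)).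
Qed.

(** Innermost recolourings are played one after another until, at cost 0, a single component of
    colour [d] remains; covers never shrink on the way. *)
Lemma deriv_sound w X A d N c :
  deriv w X d N c -> A \subset cover X ->
  exists s, size s = c /\ linked e A (play e w s) d.
Proof.
elim: c w X N => [|c IHc] w X N dX sub.
  have [v Xv vd] := deriv_free dX erefl.
  by exists [::]; split=> //; exists v; rewrite Xv cover1 in sub.
have [v [b [_ dX']]] := deriv_first_move (deriv_uniq dX) erefl isT.
have [|s [sz lnk]] := IHc _ _ _ dX'.
  exact: subset_trans sub (cover_grow _ _ _ _).
by exists ((v, b) :: s); rewrite /= sz.
Qed.

(** Moves are undone from the last to the first, each adding at most one to the cost; repeated
    leaves are removed before every undoing. *)
Lemma deriv_complete w A d s :
  linked e A (play e w s) d ->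
  exists X N c, [/\ deriv w X d N c, A \subset cover X & c <= size s].
Proof.
elim: s w => [|[v b] s IHs] w /=.
  case=> v [vd sub]; exists [set mc w v], 1, 0; rewrite cover1 -vd.
  by split=> //; apply: DLeaf.
case/IHs=> X [N [c [dX sub lec]]].
have [Y [N' [c' [dY sub' lec']]]] := deriv_unmove (deriv_uniq dX) erefl.
exists Y, N', c'; split=> //; first exact: subset_trans sub sub'.
by move: lec'; case: (_ \in _) => /=; lia.
Qed.

Lemma deriv_full w d :
  connected_graph e -> exists X N c, [/\ deriv w X d N c, cover X = setT & c <= #|V|].
Proof.
case=> /card_gt0P [v0 _] conn.
(* Each component is recoloured to [d] separately before it is attached, so the cost is the number
   of components. *)
suff aux n X N : deriv w X d N #|X| -> #|~: cover X| < n ->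
    exists Y M c, [/\ deriv w Y d M c, cover Y = setT & c <= #|V|].
  apply: aux (ltnSn #|~: cover [set mc w v0]|).
  by rewrite cards1; apply: DRecolour (DLeaf w v0).
elim: n X N => // n IHn X N dX ltn.
have [cX|] := eqVneq (cover X) setT.
  by exists X, N, #|X|; split=> //; apply: card_deriv dX.
rewrite -subTset => /subsetPn [z _ zX].
have [x xX] : exists x, x \in cover X.
  have [_ N0] := deriv_leaves (deriv_uniq dX).
  have [K KX] := card_gt0P N0; have [u Ku] := deriv_component dX KX.
  by exists u; apply/bigcupP; exists K; rewrite // Ku mono_component_refl.
have [x' [y [x'X yX exy _]]] := connect_escape (conn x z) xX zX.
have dY : deriv w (X :|: [set mc w y]) d (N + 1) (#|X| + 1).
  apply: DMerge dX (DRecolour d (DLeaf w y)) x'X _ exy.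
  by rewrite cover1 mono_component_refl.
have yX' : mc w y \notin X.
  by apply: contra yX => yX; apply/bigcupP; exists (mc w y); rewrite // mono_component_refl.
apply: (IHn (X :|: [set mc w y]) (N + 1)).
  by rewrite (_ : #|_| = #|X| + 1) // setUC cardsU1 yX' addnC.
rewrite -ltnS; apply: leq_trans ltn; rewrite ltnS; apply: proper_card.
apply/properP; split; first by rewrite setCS coverU subsetUl.
exists y; first by rewrite inE.
by rewrite inE coverU inE cover1 mono_component_refl orbT.
Qed.

End Derivations.

(** The flag [true] puts a position into the first part of a merge; positions of the other part are
    filled with an endpoint of the joining edge. *)
Definition left_part (T : Type) (x : T) (z : seq (bool * T)) : seq T :=
  [seq if a.1 then a.2 else x | a <- z].
Definition right_part (T : Type) (y : T) (z : seq (bool * T)) : seq T :=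
  [seq if a.1 then y else a.2 | a <- z].

(** * Tables of costs indexed by tuples and colours *)

Section Tables.
Variables (V C : finType) (e : rel V) (w : {ffun V -> C}) (k : nat).
Hypotheses (sym_e : symmetric e) (conn : connected_graph e).
Hypothesis proper_w : proper_colouring e w.
Implicit Types (t : seq V) (z : seq (bool * V)) (T : seq V -> C -> nat) (d : C).

(** This is the soundness half of the table invariant: an entry is an upper bound witnessed by a
    derivation. [complete_upto] is the other half. *)
Definition reaches t d m : Prop :=
  exists X N c, [/\ deriv e w X d N c, {subset t <= cover X} & c <= m].

Lemma reaches_full t d : reaches t d #|V|.
Proof.
have [X [N [c [dX cX lec]]]] := deriv_full w d conn.
by exists X, N, c; split=> // v; rewrite cX inE.
Qed.

Lemma reaches_const v : reaches (nseq k v) (w v) 0.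
Proof.
exists [set mono_component e w v], 1, 0; split=> //; first exact: DLeaf.
by move=> u /nseqP [-> _]; rewrite cover1 mono_component_refl.
Qed.

Lemma reaches_recolour t a d m : reaches t a m -> reaches t d m.+1.
Proof.
case=> X [N [c [dX sub lec]]]; exists X, N, c.+1.
by split=> //; apply: DRecolour dX.
Qed.

(* When all positions of the tuple lie in one part, the endpoint of the edge in
   the other part need not be reached, but then that part is superfluous. *)
Lemma reaches_merge z x y d m1 m2 :
  e x y -> reaches (left_part x z) d m1 -> reaches (right_part y z) d m2 ->
  reaches (unzip2 z) d (m1 + m2).
Proof.
move=> exy [X [N1 [c1 [dX subX le1]]]] [Y [N2 [c2 [dY subY le2]]]].
have [allT|] := boolP (all fst z).
  exists X, N1, c1; split=> //; last by lia.
  rewrite (_ : unzip2 z = left_part x z) //.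
  by apply/eq_in_map=> a /(allP allT) ->.
have [allF|] := boolP (all (fun a => ~~ a.1) z).
  exists Y, N2, c2; split=> //; last by lia.
  rewrite (_ : unzip2 z = right_part y z) //.
  by apply/eq_in_map=> a /(allP allF) /negPf ->.
case/allPn=> -[[] u] //= zu _; case/allPn=> -[[] v] //= zv _.
exists (X :|: Y), (N1 + N2), (c1 + c2); split; last by lia.
  apply: DMerge dX dY _ _ exy.
    by apply: subX; apply/mapP; exists (false, v).
  by apply: subY; apply/mapP; exists (true, u).
move=> _ /mapP [[b v'] zv' ->] /=; rewrite coverU inE; apply/orP.
case: b zv' => zv'; [left; apply: subX | right; apply: subY].
  by apply/mapP; exists (true, v').
by apply/mapP; exists (false, v').
Qed.

Lemma proper_component v : mono_component e w v = [set v].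
Proof.
apply/setP=> u; rewrite !inE; apply/idP/eqP=> [/connectP [[|x p] /=]|->].
- by move=> _ ->.
- by case/andP=> /andP [/proper_w /negPf ->].
exact: connect0.
Qed.

Definition complete_upto T r := forall X d N c t,
  deriv e w X d N c -> N + c <= r -> size t = k -> {subset t <= cover X} ->
  T t d <= c.

(** Cutting a derivation at its root lowers [N + c]: a recolouring gives up one unit of cost, and
    each part of a merge leaves at least one leaf to the other. *)
Lemma complete_step T T' r :
  (forall v, T' (nseq k v) (w v) = 0) ->
  (forall t a d, size t = k -> T' t d <= (T t a).+1) ->
  (forall z x y d, size z = k -> e x y ->
     T' (unzip2 z) d <= T (left_part x z) d + T (right_part y z) d) ->
  complete_upto T r -> complete_upto T' r.+1.
Proof.
move=> leaf rec merge IH X d N c t; case=> {X d N c}.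
- move=> v _ szt sub; rewrite (_ : t = nseq k v) ?leaf // -szt.
  apply/all_pred1P/allP=> u /sub; rewrite cover1 proper_component inE.
  by [].
- move=> X a d N c dX; rewrite addnS ltnS => le szt sub.
  by apply: leq_trans (rec t a d szt) _; rewrite ltnS; apply: IH dX le szt sub.
move=> X Y d N1 N2 c1 c2 x y dX dY xX yY exy le szt sub.
(* Positions covered by both parts are assigned to the first. *)
pose z := [seq (v \in cover X, v) | v <- t].
have zt : unzip2 z = t by rewrite /unzip2 -map_comp map_id_in.
have [_ N1p] := deriv_leaves dX; have [_ N2p] := deriv_leaves dY.
rewrite -zt; apply: leq_trans (merge _ x y d _ exy) _; first by rewrite size_map.
apply: leq_add.
  apply: IH dX _ _ _; [lia | by rewrite !size_map |].
  by move=> _ /mapP [_ /mapP [v _ ->] ->] /=; case: ifP.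
apply: IH dY _ _ _; [lia | by rewrite !size_map |].
move=> _ /mapP [_ /mapP [v tv ->] ->] /=; case: ifP => // vX.
by have := sub _ tv; rewrite coverU inE vX.
Qed.

Lemma complete0 T : complete_upto T 0.
Proof. by move=> X d N c t /deriv_leaves [_]; case: N. Qed.

Lemma complete_min_moves T (U : {set V}) t d :
  size t = k -> t =i U -> reaches t d (T t d) -> T t d <= #|V| ->
  complete_upto T (#|V| + #|V|) -> min_moves e U w d (T t d).
Proof.
move=> szt tU [X [N [c [dX sub lec]]]] leT compl.
(* Costs above [#|V|] are handled by the a priori bound on [T t d]; otherwise removing repetitions
   leaves at most [#|V|] leaves, so [N + c] is at most twice [#|V|]. *)
have lower X' N' c' : deriv e w X' d N' c' -> U \subset cover X' -> T t d <= c'.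
  move=> dX' /subsetP sub'; case: (leqP c' #|V|) => [lec'|]; last by lia.
  apply: compl (deriv_uniq dX') _ szt _.
    by rewrite leq_add // (card_deriv dX').
  by move=> u; rewrite tU; apply: sub'.
have subU : U \subset cover X by apply/subsetP=> u; rewrite -tU; apply: sub.
have eqc : T t d = c by apply/eqP; rewrite eqn_leq lec (lower _ _ _ dX).
split; first by rewrite eqc; apply: (deriv_sound sym_e dX subU).
move=> s /(deriv_complete sym_e) [X' [N' [c' [dX' sub' lec']]]].
by apply: leq_trans lec'; apply: lower dX' sub'.
Qed.

End Tables.

(** * Time-bounded weakest preconditions *)

Definition wp (p : prog) (T : nat) (Q : state -> Prop) (s : state) : Prop :=
  exists t s', [/\ exec p s t s', t <= T & Q s'].

Lemma wp_weaken p T T' (Q Q' : state -> Prop) s :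
  wp p T Q s -> T <= T' -> (forall s', Q s' -> Q' s') -> wp p T' Q' s.
Proof.
case=> t [s' [ex le q]] leT QQ'; exists t, s'; split=> //; last exact: QQ'.
exact: leq_trans leT.
Qed.

Lemma wp_seq p p' T T' Q s :
  wp p T (wp p' T' Q) s -> wp (Seq p p') (T + T') Q s.
Proof.
case=> t [s' [ex le [t' [s'' [ex' le' q]]]]].
by exists (t + t'), s''; split=> //; [apply: ExecSeq ex ex' | apply: leq_add].
Qed.

Lemma wp_if a p p' T Q s :
  (eval s a != 0 -> wp p T Q s) -> (eval s a = 0 -> wp p' T Q s) ->
  wp (If a p p') (cost a + T).+1 Q s.
Proof.
move=> H H'; have [E|E] := eqVneq (eval s a) 0.
  have [t [s' [ex le q]]] := H' E; exists (cost a + t).+1, s'.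
  by split=> //; [apply: ExecIfFalse | rewrite ltnS leq_add2l].
have [t [s' [ex le q]]] := H E; exists (cost a + t).+1, s'.
by split=> //; [apply: ExecIfTrue | rewrite ltnS leq_add2l].
Qed.

Lemma wp_while a p T m (I : nat -> state -> Prop) s :
  I 0 s ->
  (forall i s, i < m -> I i s -> eval s a != 0 /\ wp p T (I i.+1) s) ->
  (forall s, I m s -> eval s a = 0) ->
  wp (While a p) (m * (cost a + T).+1 + (cost a).+1) (I m) s.
Proof.
move=> I0 IS Im.
suff aux j i s1 : i + j = m -> I i s1 ->
    wp (While a p) (j * (cost a + T).+1 + (cost a).+1) (I m) s1.
  exact: aux (add0n m) I0.
elim: j i s1 => [|j IHj] i s1.
  rewrite addn0 => -> I1; exists (cost a).+1, s1; split=> //.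
  by apply: ExecWhileDone; apply: Im.
rewrite addnS -addSn => eqm I1.
have [|E [t [s2 [ex le I2]]]] := IS i s1 _ I1; first by rewrite -eqm leq_addr.
have [t' [s3 [ex' le' I3]]] := IHj _ _ eqm I2.
exists (cost a + t + t').+1, s3; split=> //; first exact: ExecWhileLoop ex ex'.
by rewrite mulSn; lia.
Qed.

(** Loop-free code is executed by mere computation: [run] gives the final state and [run_cost]
    charges the costlier branch of each test. *)
Fixpoint straight p :=
  match p with
  | Seq p p' | If _ p p' => straight p && straight p'
  | While _ _ => false
  | _ => true
  end.

Fixpoint run p s :=
  match p with
  | Assign x a => set_reg s x (eval s a)
  | Store a b => set_mem s (eval s a) (eval s b)
  | Seq p p' => run p' (run p s)
  | If a p p' => if eval s a != 0 then run p s else run p' s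
  | _ => s
  end.

Fixpoint run_cost p :=
  match p with
  | Assign _ a => (cost a).+1
  | Store a b => (cost a + cost b).+1
  | Seq p p' => run_cost p + run_cost p'
  | If a p p' => (cost a + maxn (run_cost p) (run_cost p')).+1
  | _ => 1
  end.

Lemma wp_run p T (Q : state -> Prop) s :
  straight p -> run_cost p <= T -> Q (run p s) -> wp p T Q s.
Proof.
move=> str leT; suff H : wp p (run_cost p) (eq (run p s)) s.
  by move=> q; apply: wp_weaken H leT _ => _ <-.
elim: p s str {T Q leT} => [|x a|a b|p IHp p' IHp'|a p IHp p' IHp'|//] s /=.
- by exists 1, s; split=> //; apply: ExecSkip.
- by eexists _, _; split; [apply: ExecAssign | |].
- by eexists _, _; split; [apply: ExecStore | |].
- case/andP=> sp sp'; apply: wp_seq; apply: wp_weaken (IHp s sp) (leqnn _) _.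
  by move=> _ <-; apply: IHp'.
case/andP=> sp sp'; apply: wp_if => [-> | ->] /=.
  by apply: wp_weaken (IHp s sp) (leq_maxl _ _) _.
by apply: wp_weaken (IHp' s sp') (leq_maxr _ _) _.
Qed.

Definition For x y p :=
  Seq (Assign x (Const 0))
    (While (Defs.Sub (Reg y) (Reg x)) (Seq p (Assign x (Add (Reg x) (Const 1))))).

Lemma wp_for x y p T m (I : nat -> state -> Prop) s :
  x != y -> reg s y = m -> I 0 (set_reg s x 0) ->
  (forall i s1, i < m -> reg s1 x = i -> reg s1 y = m -> I i s1 ->
     wp p T (fun s2 => [/\ reg s2 x = i, reg s2 y = m
                         & I i.+1 (set_reg s2 x i.+1)]) s1) ->
  wp (For x y p) (m * (T + 8) + 6) (I m) s.
Proof.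
move=> neq ym I0 IS.
pose J i s1 := [/\ reg s1 x = i, reg s1 y = m & I i s1].
(* Initialising costs 2; an iteration costs 3 for the test, 1 for the loop and 4 for the increment
   besides [T]; the failing test costs 4. *)
have -> : m * (T + 8) + 6 = 2 + (m * (3 + (T + 4)).+1 + 4) by lia.
apply: wp_seq; apply: wp_run => //.
suff H : wp (While (Defs.Sub (Reg y) (Reg x)) (Seq p (Assign x (Add (Reg x) (Const 1)))))
            (m * (3 + (T + 4)).+1 + 4) (J m) (set_reg s x 0).
  by apply: wp_weaken H _ _ => // s1 [].
apply: wp_while.
- by split=> //=; rewrite ?eqxx // eq_sym (negPf neq).
- move=> i s1 lti [xi yi Ii]; split; first by rewrite /= xi yi subn_eq0 -ltnNge.
  apply: wp_seq; apply: wp_weaken (IS i s1 lti xi yi Ii) (leqnn _) _.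
  move=> s2 [xi2 yi2 Ii2]; apply: wp_run => //=.
  by split; rewrite /= ?xi2 ?addn1 ?eqxx // eq_sym (negPf neq).
by move=> s1 [xi yi _]; rewrite /= xi yi subnn.
Qed.

(** * Lists laid out in memory *)

Definition mem_at (f : nat -> nat) b (l : seq nat) :=
  forall i, i < size l -> f (b + i) = nth 0 l i.

Lemma mem_at_cat f b l1 l2 :
  mem_at f b (l1 ++ l2) <-> mem_at f b l1 /\ mem_at f (b + size l1) l2.
Proof.
split=> [H|[H1 H2] i]; last first.
  rewrite size_cat nth_cat; case: (ltnP i (size l1)) => [lt _|le lt]; first exact: H1.
  by rewrite -[i in b + i](subnKC le) addnA H2 // ltn_subLR.
split=> i lti.
  by have := H i; rewrite size_cat nth_cat lti; apply; apply: ltn_addr.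
have := H (size l1 + i); rewrite size_cat nth_cat ltn_add2l lti addKn.
by rewrite ltnNge leq_addr addnA; apply.
Qed.

Lemma nth_flatten_block (T : Type) (x0 : T) m ss i j :
  all (fun s => size s == m) ss -> j < m ->
  nth x0 (flatten ss) (i * m + j) = nth x0 (nth [::] ss i) j.
Proof.
move=> + ltj; elim: ss i => [|s ss IHss] i; first by rewrite !nth_nil.
case/andP=> /eqP sz all_ss /=; rewrite nth_cat sz.
case: i => [|i]; first by rewrite ltj.
by rewrite mulSn -addnA ltnNge leq_addr /= addKn IHss.
Qed.

Lemma size_flatten_block (T : Type) m (ss : seq (seq T)) :
  all (fun s => size s == m) ss -> size (flatten ss) = size ss * m.
Proof.
by elim: ss => //= s ss IHss /andP [/eqP sz /IHss]; rewrite size_cat sz => ->.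
Qed.

(** * Codes of tuples *)

Section Codes.
Variables n q : nat.

(* The weight [q] of the last digit leaves room for a colour below it. *)
Fixpoint wsum (T : Type) (f : T -> nat) (s : seq T) : nat :=
  if s is a :: s' then wsum f s' + f a * (q * n ^ size s') else 0.

Lemma eq_wsum (T : Type) (f g : T -> nat) s : f =1 g -> wsum f s = wsum g s.
Proof. by move=> fg; elim: s => //= a s ->; rewrite fg. Qed.

Lemma wsum_map (T T' : Type) (f : T' -> nat) (g : T -> T') s :
  wsum f (map g s) = wsum (f \o g) s.
Proof. by elim: s => //= a s ->; rewrite size_map. Qed.

Lemma wsumD (T : Type) (f g : T -> nat) s :
  wsum f s + wsum g s = wsum (fun a => f a + g a) s.
Proof. by elim: s => //= a s <-; rewrite mulnDl; lia. Qed.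

Lemma wsumM (T : Type) m (f : T -> nat) s :
  m * wsum f s = wsum (fun a => m * f a) s.
Proof. by elim: s => [|a s IHs] /=; rewrite ?muln0 // mulnDr IHs mulnA. Qed.

Lemma wsum_lt (T : Type) (f : T -> nat) s c :
  (forall a, f a < n) -> c < q -> wsum f s + c < q * n ^ size s.
Proof.
move=> ltf ltc; elim: s => [|a s IHs] /=; first by rewrite muln1.
rewrite expnS [q * (n * _)]mulnCA; apply: (@leq_trans ((f a).+1 * (q * n ^ size s))).
  by rewrite mulSn; lia.
by rewrite leq_mul2r ltf orbT.
Qed.

(** By [wsum_lt], everything below the leading digit is smaller than its weight, so division
    recovers that digit and induction the rest. *)
Lemma wsum_inj (T : Type) (f : T -> nat) s s' c c' :
  (forall a, f a < n) -> injective f -> c < q -> c' < q -> size s = size s' ->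
  wsum f s + c = wsum f s' + c' -> s = s' /\ c = c'.
Proof.
move=> ltf injf ltc ltc'; elim: s s' => [|a s IHs] [|a' s'] //= [eqsz].
rewrite addnAC [_ + c']addnAC -eqsz => eqv.
have lts := wsum_lt s ltf ltc; have lts' := wsum_lt s' ltf ltc'.
rewrite -eqsz in lts'; set P := q * _ in eqv lts lts'.
have P0 : 0 < P by apply: leq_ltn_trans lts.
have eqa : f a = f a'.
  have := congr1 (divn^~ P) eqv.
  by rewrite /= addnC divnMDl // addnC [in RHS]addnC divnMDl // !divn_small ?addn0.
have [|-> ->] := IHs s' eqsz; first by move: eqv; rewrite eqa => /addIn.
by rewrite (injf _ _ eqa).
Qed.

End Codes.

Section Rank.
Variable T : finType.

Lemma rank_lt (x : T) : rank x < #|T|. Proof. exact: ltn_ord. Qed.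

Lemma rank_inj : injective (@rank T).
Proof. by move=> x y /val_inj /enum_rank_inj. Qed.

Lemma nth_rank x0 (x : T) : nth x0 (enum T) (rank x) = x.
Proof. exact: nth_enum_rank. Qed.

Lemma rank_surj i : i < #|T| -> exists x : T, rank x = i.
Proof.
by move=> lti; exists (enum_val (Ordinal lti)); rewrite /rank enum_valK.
Qed.

Lemma take_rank (x : T) :
  take (rank x).+1 (enum T) = rcons (take (rank x) (enum T)) x.
Proof. by rewrite (take_nth x) ?nth_rank // -cardE rank_lt. Qed.

End Rank.

Section Quads.
Variables (V : finType) (q : nat).
Local Notation n := #|V|.
Implicit Types (z : seq (bool * V)) (t : seq V).

Definition code t := wsum n q (@rank V) t.

(* A list [z] is a tuple with a choice of positions.  Its quad holds the partial
   codes of the chosen and of the other positions, and the weights of the chosen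
   and of the other positions, which make the codes of [left_part x z] and
   [right_part y z] affine in the ranks of [x] and [y]. *)
Definition quad z :=
  [:: wsum n q (fun a : bool * V => a.1 * rank a.2) z;
      wsum n q (fun a : bool * V => ~~ a.1 * rank a.2) z;
      wsum n q (fun a : bool * V => a.1 : nat) z;
      wsum n q (fun a : bool * V => ~~ a.1 : nat) z].

Definition quads zs := flatten (map quad zs).

Lemma code_unzip2 z : nth 0 (quad z) 0 + nth 0 (quad z) 1 = code (unzip2 z).
Proof. by rewrite /code wsum_map wsumD; apply: eq_wsum => -[[] v] /=; lia. Qed.

Lemma code_left x z :
  nth 0 (quad z) 0 + rank x * nth 0 (quad z) 3 = code (left_part x z).
Proof. by rewrite /code wsum_map wsumM wsumD; apply: eq_wsum => -[[] v] /=; lia. Qed.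

Lemma code_right y z :
  nth 0 (quad z) 1 + rank y * nth 0 (quad z) 2 = code (right_part y z).
Proof. by rewrite /code wsum_map wsumM wsumD; apply: eq_wsum => -[[] v] /=; lia. Qed.

(** Constant tuples have equally spaced codes, so the program walks through them by repeated
    addition. *)
Lemma code_nseq k v : code (nseq k v) = rank v * wsum n q (fun=> 1) (nseq k tt).
Proof.
rewrite wsumM /code -(map_nseq k (fun _ : unit => v) tt) wsum_map.
by apply: eq_wsum => _ /=; rewrite muln1.
Qed.

Lemma code_lt t (C : finType) (d : C) :
  q = #|C| -> code t + rank d < q * n ^ size t.
Proof.
by move=> eqq; apply: wsum_lt; [apply: rank_lt | rewrite eqq rank_lt].
Qed.

Lemma code_inj t t' (C : finType) (d d' : C) :
  q = #|C| -> size t = size t' -> code t + rank d = code t' + rank d' ->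
  t = t' /\ d = d'.
Proof.
move=> eqq sz; case/wsum_inj=> //; rewrite ?eqq; try exact: rank_lt.
  exact: rank_inj.
by move=> -> /rank_inj.
Qed.

Definition extend z vs :=
  flatten [seq [:: (true, v) :: z; (false, v) :: z] | v <- vs].

(** The order is the one in which the queue produces the flagged tuples. *)
Fixpoint level i :=
  if i is j.+1 then flatten [seq extend z (enum V) | z <- level j] else [:: [::]].

Lemma size_extend z vs : size (extend z vs) = 2 * size vs.
Proof. by elim: vs => //= v vs IHvs; rewrite IHvs mulnS. Qed.

Lemma size_level i : size (level i) = (2 * n) ^ i.
Proof.
elim: i => //= i IHi; rewrite (@size_flatten_block _ (2 * n)).
  by rewrite size_map IHi expnSr.
by apply/allP=> _ /mapP [z _ ->]; rewrite size_extend -cardE.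
Qed.

Lemma mem_level i z : (z \in level i) = (size z == i).
Proof.
elim: i z => [|i IHi] z /=; first by rewrite inE size_eq0.
apply/flattenP/idP=> [[_ /mapP [z' z'i ->]]|].
  case/flattenP=> _ /mapP [v _ ->]; rewrite IHi in z'i.
  by rewrite !inE => /orP [] /eqP -> /=; rewrite eqSS.
case: z => [|[b v] z] //=; rewrite eqSS -IHi => zi.
exists (extend z (enum V)); first exact: map_f.
apply/flattenP; exists [:: (true, v) :: z; (false, v) :: z].
  by apply: map_f; rewrite mem_enum.
by rewrite !inE; case: b; rewrite eqxx ?orbT.
Qed.

Lemma quads_cat zs zs' : quads (zs ++ zs') = quads zs ++ quads zs'.
Proof. by rewrite /quads map_cat flatten_cat. Qed.

Lemma size_quads zs : size (quads zs) = 4 * size zs.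
Proof. by elim: zs => //= z zs IHzs; rewrite IHzs mulnS. Qed.

Lemma nth_quads zs i j : j < 4 -> i < size zs ->
  nth 0 (quads zs) (i * 4 + j) = nth 0 (quad (nth [::] zs i)) j.
Proof.
move=> ltj lti; rewrite nth_flatten_block ?(nth_map [::]) //.
by apply/allP=> _ /mapP [z _ ->].
Qed.

End Quads.

(** * Positions of the input fields in memory *)

Section Input.
Variables (V C : finType) (e : rel V) (w : {ffun V -> C}) (U : {set V}) (d : C).
Local Notation n := #|V|.
Local Notation inp := (nth 0 (encode e w U d)).

Definition input_size := 4 + n + #|U| + n * n.

Lemma input_colour v : inp (4 + rank v) = rank (w v).
Proof.
rewrite /= nth_cat size_map -cardE rank_lt (nth_map v) -?cardE ?rank_lt //.
by rewrite nth_rank.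
Qed.

Lemma input_set v0 i : i < #|U| -> inp (4 + n + i) = rank (nth v0 (enum U) i).
Proof.
move=> lti; rewrite /= nth_cat size_map -cardE ltnNge leq_addr /= addKn.
by rewrite nth_cat size_map -cardE lti (nth_map v0) // -cardE.
Qed.

Lemma input_edge u v : inp (4 + n + #|U| + (rank u * n + rank v)) = e u v.
Proof.
rewrite -!addnA [nth _ _ _]/= add0n nth_cat size_map -cardE ltnNge leq_addr /= addKn.
rewrite nth_cat size_map -cardE ltnNge leq_addr /= addKn.
rewrite nth_flatten_block ?rank_lt //.
  rewrite (nth_map u [::]) -?cardE ?rank_lt // nth_rank.
  by rewrite (nth_map v 0) -?cardE ?rank_lt // nth_rank.
by apply/allP=> _ /mapP [x _ ->]; rewrite size_map -cardE.
Qed.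

Lemma input_blank i : input_size <= i -> inp i = 0.
Proof.
move=> le; apply: nth_default; apply: leq_trans le.
by rewrite /input_size /encode !size_cat !size_map size_allpairs -?enumT -!cardE /=; lia.
Qed.

End Input.

(** * The rounds of relaxation *)

(* Register 1 holds |V|, 2 |C|, 3 |U|, 4 the address of the adjacency matrix, 5
   the number of rounds, 6 the address of the quads, 7 that of the table, which
   follows them, 8 the weight of the next digit (finally the size of the table),
   9 the code of U and 10 the code of a tuple of ones.  Inner loops only change
   registers with larger numbers than those of outer loops. *)
Definition Relax a b := If (Defs.Sub (Fetch a) b) (Store a b) Skip.

(** The sum of registers 16 and 17 is the address of the entry to be lowered; 20 and 22 address the
    entries of the left and right parts, 23 the adjacency cell. Adding the weight of the chosen
    positions to register 22 passes to the next [y] without multiplication. *)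
Definition merge_step :=
  Seq (If (Fetch (Reg 23))
         (Relax (Add (Reg 16) (Reg 17)) (Add (Fetch (Reg 20)) (Fetch (Reg 22))))
         Skip)
    (Seq (Assign 22 (Add (Reg 22) (Fetch (Add (Reg 13) (Const 2)))))
         (Assign 23 (Add (Reg 23) (Const 1)))).

Definition merge_from :=
  Seq (Seq (Assign 22 (Add (Reg 15) (Reg 17))) (Assign 23 (Reg 19)))
    (Seq (For 21 1 merge_step)
      (Seq (Assign 19 (Add (Reg 19) (Reg 1)))
           (Assign 20 (Add (Reg 20) (Fetch (Add (Reg 13) (Const 3))))))).

Definition relax_colour :=
  Seq (Seq (Assign 19 (Reg 4)) (Assign 20 (Add (Reg 14) (Reg 17))))
    (Seq (For 18 1 merge_from)
      (For 18 2 (Relax (Add (Reg 16) (Reg 17))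
                       (Add (Fetch (Add (Reg 16) (Reg 18))) (Const 1))))).

Definition relax_quad :=
  Seq (Seq (Assign 14 (Add (Fetch (Reg 13)) (Reg 7)))
      (Seq (Assign 15 (Add (Fetch (Add (Reg 13) (Const 1))) (Reg 7)))
           (Assign 16 (Add (Fetch (Reg 13)) (Reg 15)))))
    (Seq (For 17 2 relax_colour) (Assign 13 (Add (Reg 13) (Const 4)))).

Definition round :=
  Seq (Assign 13 (Reg 6)) (While (Defs.Sub (Reg 7) (Reg 13)) relax_quad).

Section Rounds.
Variables (V C : finType) (e : rel V) (w : {ffun V -> C}) (U : {set V}) (d0 : C).
Variables (R0 : nat -> nat).
Local Notation n := #|V|.
Local Notation q := #|C|.
Local Notation k := #|U|.
Local Notation inp := (nth 0 (encode e w U d0)).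
Local Notation rp := (R0 6).
Local Notation fb := (R0 7).
Local Notation code := (code q).
Local Notation quad := (quad q).
Local Notation level := (level V k).
Implicit Types (s : state) (t : seq V) (z : seq (bool * V)) (d c : C).

Definition tab (f : nat -> nat) t d := f (fb + (code t + rank d)).

Definition memory_inv (f : nat -> nat) :=
  [/\ forall j, j < input_size U -> f j = inp j,
      mem_at f rp (quads q level)
    & forall t d, size t = k -> reaches e w t d (tab f t d)].

Definition table_inv s := (forall r, r < 11 -> reg s r = R0 r) /\ memory_inv (cell s).

(** Entries never increase, so an inequality between a new entry and earlier ones survives all later
    stores; this makes updating the table in place harmless. *)
Definition refines m s s' :=
  [/\ forall r, r < m -> reg s' r = reg s r,
      forall j, cell s' j <= cell s j & table_inv s -> table_inv s'].

Lemma refines_refl m s : refines m s s. Proof. by []. Qed.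

Lemma refines_trans m m1 m2 s s1 s2 :
  refines m1 s s1 -> refines m2 s1 s2 -> m <= m1 -> m <= m2 -> refines m s s2.
Proof.
case=> r1 c1 i1 [r2 c2 i2] le1 le2; split=> [r ltr|j|/i1 /i2 //].
  by rewrite r2 ?r1 //; apply: leq_trans ltr _.
exact: leq_trans (c2 j) (c1 j).
Qed.

Lemma refines_set_reg m s x v : 11 <= x -> m <= x -> refines m s (set_reg s x v).
Proof.
move=> lex lem; split=> [r ltr|//|[ir im]]; last split=> // r ltr.
  by rewrite /= ifF // ltn_eqF // (leq_trans ltr).
by rewrite /= ifF ?ir // ltn_eqF // (leq_trans ltr).
Qed.

Lemma refines_set m s s' x v :
  refines m s s' -> 11 <= x -> m <= x -> refines m s (set_reg s' x v).
Proof.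
by move=> rel lex lem; apply: refines_trans rel (refines_set_reg s' v lex lem) _ _.
Qed.

Lemma refines_tab m s s' t d : refines m s s' -> tab (cell s') t d <= tab (cell s) t d.
Proof. by case=> _ le _; apply: le. Qed.

Hypotheses (regs1 : R0 1 = n) (regs2 : R0 2 = q) (regs4 : R0 4 = 4 + n + k).
Hypotheses (le_rp : input_size U <= rp) (fbE : fb = rp + 4 * size level).

(** The table lies beyond the input and the quads, and codes are injective, so the store affects one
    entry only. *)
Lemma memory_inv_update f t d v :
  memory_inv f -> size t = k -> reaches e w t d v ->
  memory_inv [eta f with fb + (code t + rank d) |-> v].
Proof.
case=> f_inp f_quads f_tab szt tv; split=> [j ltj|i lti|t' d' szt'] /=.
- by rewrite ifF ?f_inp //; apply/eqP; lia.
- by rewrite size_quads in lti; rewrite ifF ?f_quads ?size_quads //; apply/eqP; lia.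
rewrite /tab /= eqn_add2l; case: eqP => [/code_inj [] // | _]; last exact: f_tab.
  by rewrite szt'.
by move=> -> ->.
Qed.

Lemma wp_relax m a b t d s :
  table_inv s -> size t = k -> eval s a = fb + (code t + rank d) ->
  reaches e w t d (eval s b) ->
  wp (Relax a b) (2 * (cost a + cost b) + 4)
    (fun s' => [/\ reg s' = reg s, refines m s s' & tab (cell s') t d <= eval s b]) s.
Proof.
move=> [ir im] szt sa tb.
have -> : 2 * (cost a + cost b) + 4 =
  (cost (Defs.Sub (Fetch a) b) + (cost a + cost b).+1).+1 by rewrite /=; lia.
apply: wp_if => /= E; apply: wp_run => //=.
  rewrite -lt0n subn_gt0 in E; split=> //; last by rewrite /tab /= sa eqxx.
  split=> // [j|_]; last by split=> //=; rewrite sa; apply: memory_inv_update.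
  by rewrite /=; case: eqP => // ->; apply: ltnW.
by split=> //; rewrite /tab -sa -subn_eq0 E.
Qed.

Definition quad_ctx i s :=
  [/\ reg s 13 = rp + i * 4, reg s 14 = fb + nth 0 (quad (nth [::] level i)) 0,
      reg s 15 = fb + nth 0 (quad (nth [::] level i)) 1
    & reg s 16 = fb + code (unzip2 (nth [::] level i))].

Lemma quad_ctx_refines m i s s' :
  refines m s s' -> 16 < m -> quad_ctx i s -> quad_ctx i s'.
Proof. by case=> r _ _ ltm [? ? ? ?]; split; rewrite r //; lia. Qed.

Lemma quad_cell i j s : table_inv s -> i < size level -> j < 4 ->
  cell s (rp + i * 4 + j) = nth 0 (quad (nth [::] level i)) j.
Proof.
case=> _ [_ s_quads _] lti ltj; rewrite -addnA s_quads; last by rewrite size_quads; lia.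
exact: nth_quads.
Qed.

Lemma adjacency_cell x y s : table_inv s ->
  cell s (4 + n + k + (rank x * n + rank y)) = e x y.
Proof.
case=> _ [s_inp _ _]; rewrite s_inp ?input_edge // /input_size ltn_add2l.
have := rank_lt x; have := rank_lt y.
move: (rank x) (rank y) => a b ltb lta; nia.
Qed.

Lemma size_nth_level i : i < size level -> size (nth [::] level i) = k.
Proof. by move=> lti; apply/eqP; rewrite -mem_level mem_nth. Qed.

Definition merge_time := n * (60 + 8) + 6.

Lemma wp_merge_loop i x c s :
  let z := nth [::] level i in
  table_inv s -> i < size level -> quad_ctx i s -> reg s 17 = rank c ->
  reg s 20 = fb + code (left_part x z) + rank c ->
  reg s 22 = fb + nth 0 (quad z) 1 + rank c ->
  reg s 23 = 4 + n + k + rank x * n ->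
  wp (For 21 1 merge_step) merge_time
    (fun s' => refines 21 s s' /\ forall y, e x y ->
       tab (cell s') (unzip2 z) c <=
       tab (cell s) (left_part x z) c + tab (cell s) (right_part y z) c) s.
Proof.
move=> z inv_s lti ctx s17 s20 s22 s23.
pose I j s1 := [/\ refines 21 s s1,
  reg s1 22 = fb + nth 0 (quad z) 1 + rank c + j * nth 0 (quad z) 2,
  reg s1 23 = 4 + n + k + rank x * n + j
  & forall y, rank y < j -> e x y -> tab (cell s1) (unzip2 z) c <=
       tab (cell s) (left_part x z) c + tab (cell s) (right_part y z) c].
have szz : size z = k by apply: size_nth_level.
apply: (@wp_weaken _ merge_time _ (I n)) => //; last first.
  by move=> s' [rel _ _ fact]; split=> // y; apply: fact; apply: rank_lt.
apply: wp_for => //.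
- by have [ir _] := inv_s; rewrite ir.
- split=> //=; rewrite ?addn0 //; exact: refines_set_reg.
move=> j s1 ltj s1j s1n [rel s1_22 s1_23 fact].
have [y yj] := rank_surj ltj; rewrite -yj in s1j s1_22 s1_23 fact *.
have inv1 : table_inv s1 by case: rel => _ _; apply.
have ctx1 := quad_ctx_refines rel isT ctx.
have [s1_13 _ _ s1_16] := ctx1.
have s1_17 : reg s1 17 = rank c by case: rel => ->.
have s1_20 : reg s1 20 = fb + code (left_part x z) + rank c by case: rel => ->.
pose Q s2 := [/\ reg s2 = reg s1, refines 21 s1 s2 & e x y ->
  tab (cell s2) (unzip2 z) c <=
  tab (cell s1) (left_part x z) c + tab (cell s1) (right_part y z) c].
(* The guarded relaxation fits into 29 and the two pointer updates into 31, both rounded up. *)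
rewrite -[60]/(29 + 31); apply: wp_seq.
apply: (@wp_weaken _ _ _ Q).
- apply: (@wp_if _ _ _ 26) => /= [s1xy|s1xy].
    have exy : e x y.
      by move: s1xy; rewrite s1_23 -addnA adjacency_cell //; case: (e x y).
    have Eval : eval s1 (Add (Fetch (Reg 20)) (Fetch (Reg 22))) =
       tab (cell s1) (left_part x z) c + tab (cell s1) (right_part y z) c.
      rewrite /= /tab s1_20 s1_22 -(code_right q y z); congr (cell _ _ + cell _ _); lia.
    have tabL : reaches e w (left_part x z) c (tab (cell s1) (left_part x z) c).
      by case: inv1 => _ [_ _]; apply; rewrite size_map.
    have tabR : reaches e w (right_part y z) c (tab (cell s1) (right_part y z) c).
      by case: inv1 => _ [_ _]; apply; rewrite size_map.
    apply: wp_weaken (wp_relax 21 inv1 (t := unzip2 z) (d := c) _ _ _) _ _.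
    + by rewrite size_map.
    + by rewrite /= s1_16 s1_17 addnA.
    + by rewrite Eval; apply: reaches_merge exy tabL tabR.
    + by [].
    by move=> s2 [r2 rel2]; rewrite Eval.
  apply: wp_run => //=; split=> // exy.
  by move: s1xy; rewrite s1_23 -addnA adjacency_cell // exy.
- by [].
move=> s2 [r2 rel2 fact2]; apply: wp_run => //=.
have inv2 : table_inv s2 by case: rel2 => _ _; apply.
rewrite r2 s1j s1n; split=> //.
have rel12 : refines 21 s s2 by apply: refines_trans rel rel2 _ _.
split=> /=.
- by do 3!apply: refines_set => //.
- rewrite -[RHS]/(fb + nth 0 (quad z) 1 + rank c + (rank y).+1 * nth 0 (quad z) 2).
  by rewrite s1_22 s1_13 (quad_cell inv2 lti) // -/z mulSn; lia.
- by rewrite s1_23 addn1 addnS.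
(* Entries read in [s1] may have dropped since [s], which only strengthens the new inequality; the
   earlier ones persist because the entry on their left cannot grow. *)
move=> y'; rewrite ltnS leq_eqVlt => /orP [/eqP /rank_inj -> exy|lty exy'].
  apply: leq_trans (fact2 exy) _.
  by apply: leq_add; apply: refines_tab rel.
exact: leq_trans (refines_tab _ _ rel2) (fact _ lty exy').
Qed.

Definition source_time := 6 + (merge_time + 11).

Lemma wp_source_loop i c s :
  let z := nth [::] level i in
  table_inv s -> i < size level -> quad_ctx i s -> reg s 17 = rank c ->
  reg s 19 = 4 + n + k -> reg s 20 = fb + nth 0 (quad z) 0 + rank c ->
  wp (For 18 1 merge_from) (n * (source_time + 8) + 6)
    (fun s' => refines 18 s s' /\ forall x y, e x y ->
       tab (cell s') (unzip2 z) c <=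
       tab (cell s) (left_part x z) c + tab (cell s) (right_part y z) c) s.
Proof.
move=> z inv_s lti ctx s17 s19 s20.
pose I j s1 := [/\ refines 18 s s1, reg s1 19 = 4 + n + k + j * n,
  reg s1 20 = fb + nth 0 (quad z) 0 + rank c + j * nth 0 (quad z) 3
  & forall x, rank x < j -> forall y, e x y -> tab (cell s1) (unzip2 z) c <=
       tab (cell s) (left_part x z) c + tab (cell s) (right_part y z) c].
apply: (@wp_weaken _ (n * (source_time + 8) + 6) _ (I n)) => //; last first.
  by move=> s' [rel _ _ fact]; split=> // x; apply: fact; apply: rank_lt.
apply: wp_for => //.
- by have [ir _] := inv_s; rewrite ir.
- split=> //=; rewrite ?addn0 //; exact: refines_set_reg.
move=> j s1 ltj s1j s1n [rel s1_19 s1_20 fact].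
have [x xj] := rank_surj ltj; rewrite -xj in s1j s1_19 s1_20 fact *.
have inv1 : table_inv s1 by case: rel => _ _; apply.
have ctx1 := quad_ctx_refines rel isT ctx.
have [s1_13 s1_14 s1_15 s1_16] := ctx1.
have s1_17 : reg s1 17 = rank c by case: rel => ->.
apply: wp_seq; apply: wp_run => //; set s2 := run _ _.
have rel2 : refines 22 s1 s2 by rewrite /s2 /=; do 2!apply: refines_set => //.
have inv2 : table_inv s2 by case: rel2 => _ _; apply.
apply: wp_seq; apply: wp_weaken (wp_merge_loop (i := i) (x := x) (c := c) _ _ _ _ _ _ _) _ _ => //.
- by rewrite /= s1_20 -(code_left q x z) -/z; lia.
- by rewrite /= s1_15 s1_17.
move=> s3 [rel3 fact3]; apply: wp_run => //.
have inv3 : table_inv s3 by case: rel3 => _ _; apply.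
have rel13 : refines 19 s1 s3 by apply: refines_trans rel2 rel3 _ _.
have rel03 : refines 18 s s3 by apply: refines_trans rel rel13 _ _.
have s3r r : r < 21 -> reg s3 r = reg s1 r.
  by move=> ltr; case: rel3 => -> // _ _; case: rel2 => -> //; apply: ltnW.
split=> /=; rewrite ?s3r //.
split.
- by do 3!apply: refines_set => //.
- by rewrite /= ?s3r // s1_19 s1n mulSnr addnA.
- rewrite -[RHS]/(fb + nth 0 (quad z) 0 + rank c + (rank x).+1 * nth 0 (quad z) 3).
  by rewrite /= ?s3r // s1_20 s1_13 (quad_cell inv3 lti) // mulSnr addnA.
move=> x'; rewrite ltnS leq_eqVlt => /orP [/eqP /rank_inj -> y exy|ltx y exy].
  apply: leq_trans (fact3 y exy) _.
  by apply: leq_add; apply: leq_trans (refines_tab _ _ rel2) (refines_tab _ _ rel).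
exact: leq_trans (refines_tab _ _ rel13) (fact _ ltx _ exy).
Qed.

Lemma wp_recolour_loop i c s :
  let z := nth [::] level i in
  table_inv s -> i < size level -> quad_ctx i s -> reg s 17 = rank c ->
  wp (For 18 2 (Relax (Add (Reg 16) (Reg 17))
                      (Add (Fetch (Add (Reg 16) (Reg 18))) (Const 1))))
    (q * (22 + 8) + 6)
    (fun s' => refines 18 s s' /\ forall a,
       tab (cell s') (unzip2 z) c <= (tab (cell s) (unzip2 z) a).+1) s.
Proof.
move=> z inv_s lti ctx s17.
pose I j s1 := refines 18 s s1 /\ forall a, rank a < j ->
  tab (cell s1) (unzip2 z) c <= (tab (cell s) (unzip2 z) a).+1.
apply: (@wp_weaken _ (q * (22 + 8) + 6) _ (I q)) => //; last first.
  by move=> s' [rel fact]; split=> // a; apply: fact; apply: rank_lt.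
have szz : size (unzip2 z) = k by rewrite size_map; apply: size_nth_level.
apply: wp_for => //.
- by have [ir _] := inv_s; rewrite ir.
- by split=> //=; exact: refines_set_reg.
move=> j s1 ltj s1j s1q [rel fact].
have [a aj] := rank_surj ltj; rewrite -aj in s1j fact *.
have inv1 : table_inv s1 by case: rel => _ _; apply.
have [_ _ _ s1_16] := quad_ctx_refines rel isT ctx.
have s1_17 : reg s1 17 = rank c by case: rel => ->.
have Eval : eval s1 (Add (Fetch (Add (Reg 16) (Reg 18))) (Const 1)) =
    (tab (cell s1) (unzip2 z) a).+1.
  by rewrite /= s1_16 s1j addn1 /tab addnA.
apply: wp_weaken (wp_relax 18 inv1 (t := unzip2 z) (d := c) szz _ _) _ _.
- by rewrite /= s1_16 s1_17 addnA.
- by rewrite Eval; apply: reaches_recolour; case: inv1 => _ [_ _]; apply.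
- by [].
move=> s2 [r2 rel2]; rewrite Eval => fact2; rewrite r2 s1j s1q; split=> //.
have rel02 : refines 18 s s2 by apply: refines_trans rel rel2 _ _.
split; first by apply: refines_set.
move=> a'; rewrite ltnS leq_eqVlt => /orP [/eqP /rank_inj -> |lta].
  by apply: leq_trans fact2 _; rewrite ltnS; apply: refines_tab rel.
exact: leq_trans (refines_tab _ _ rel2) (fact _ lta).
Qed.

(** New entries stand on the left and old ones on the right, so the relation survives moving [f] to
    an earlier and [f'] to a later moment. *)
Definition relaxed z c f f' :=
  (forall x y, e x y ->
     tab f' (unzip2 z) c <= tab f (left_part x z) c + tab f (right_part y z) c) /\
  (forall a, tab f' (unzip2 z) c <= (tab f (unzip2 z) a).+1).

Lemma relaxed_weaken z c s1 s2 s3 s4 m m' :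
  refines m s1 s2 -> refines m' s3 s4 ->
  relaxed z c (cell s2) (cell s3) -> relaxed z c (cell s1) (cell s4).
Proof.
move=> rel rel' [merged recoloured]; split=> [x y exy|a].
  apply: leq_trans (refines_tab _ _ rel') _; apply: leq_trans (merged x y exy) _.
  by apply: leq_add; apply: refines_tab rel.
apply: leq_trans (refines_tab _ _ rel') _; apply: leq_trans (recoloured a) _.
by rewrite ltnS; apply: refines_tab rel.
Qed.

Definition colour_time := 6 + (n * (source_time + 8) + 6 + (q * (22 + 8) + 6)).

Lemma wp_colour_loop i s :
  let z := nth [::] level i in
  table_inv s -> i < size level -> quad_ctx i s ->
  wp (For 17 2 relax_colour) (q * (colour_time + 8) + 6)
    (fun s' => refines 17 s s' /\ forall c, relaxed z c (cell s) (cell s')) s.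
Proof.
move=> z inv_s lti ctx.
pose I j s1 := refines 17 s s1 /\ forall c, rank c < j -> relaxed z c (cell s) (cell s1).
apply: (@wp_weaken _ (q * (colour_time + 8) + 6) _ (I q)) => //; last first.
  by move=> s' [rel fact]; split=> // a; apply: fact; apply: rank_lt.
apply: wp_for => //.
- by have [ir _] := inv_s; rewrite ir.
- by split=> //=; exact: refines_set_reg.
move=> j s1 ltj s1j s1q [rel fact].
have [c cj] := rank_surj ltj; rewrite -cj in s1j fact *.
have inv1 : table_inv s1 by case: rel => _ _; apply.
have ctx1 := quad_ctx_refines rel isT ctx.
have [_ s1_14 _ _] := ctx1.
apply: wp_seq; apply: wp_run => //; set s2 := run _ _.
have rel2 : refines 18 s1 s2 by rewrite /s2 /=; do 2!apply: refines_set => //.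
have inv2 : table_inv s2 by case: rel2 => _ _; apply.
apply: wp_seq.
apply: wp_weaken (wp_source_loop (i := i) (c := c) inv2 lti _ _ _ _) _ _ => //.
- by have [ir _] := inv1; rewrite /= ir.
- by rewrite /= s1_14 s1j.
move=> s3 [rel3 merged].
have rel13 : refines 18 s1 s3 by apply: refines_trans rel2 rel3 _ _.
have inv3 : table_inv s3 by case: rel3 => _ _; apply.
apply: wp_weaken (wp_recolour_loop (i := i) (c := c) inv3 lti _ _) _ _ => //.
- exact: quad_ctx_refines rel13 isT ctx1.
- by case: rel13 => -> //; rewrite s1j.
move=> s4 [rel4 recoloured].
have rel14 : refines 18 s1 s4 by apply: refines_trans rel13 rel4 _ _.
have rel04 : refines 17 s s4 by apply: refines_trans rel rel14 _ _.
have [r14 _ _] := rel14; rewrite !r14 // s1j s1q; split=> //.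
split; first by apply: refines_set.
move=> c'; rewrite ltnS leq_eqVlt => /orP [/eqP /rank_inj -> |ltc].
  apply: (relaxed_weaken rel (refines_refl 0 _)); split=> [x y exy|a].
    apply: leq_trans (refines_tab _ _ rel4) _; apply: leq_trans (merged x y exy) _.
    by apply: leq_add; apply: refines_tab rel2.
  by apply: leq_trans (recoloured a) _; rewrite ltnS; apply: refines_tab rel13.
exact: relaxed_weaken (refines_refl 0 _) rel14 (fact c' ltc).
Qed.

Definition quad_time := 18 + (q * (colour_time + 8) + 6 + 4).

Lemma wp_quad i s :
  let z := nth [::] level i in
  table_inv s -> i < size level -> reg s 13 = rp + i * 4 ->
  wp relax_quad quad_time
    (fun s' => [/\ refines 13 s s', reg s' 13 = rp + i.+1 * 4
                 & forall c, relaxed z c (cell s) (cell s')]) s.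
Proof.
move=> z inv_s lti s13; have [ir _] := inv_s.
apply: wp_seq; apply: wp_run => //; set s1 := run _ _.
have rel1 : refines 13 s s1 by rewrite /s1 /=; do 3!apply: refines_set => //.
have inv1 : table_inv s1 by case: rel1 => _ _; apply.
have ctx1 : quad_ctx i s1.
  have cell0 := quad_cell inv_s lti (isT : 0 < 4); rewrite addn0 in cell0.
  split=> //=; rewrite ?s13 ?cell0 ?ir ?(quad_cell inv_s lti) // -/z.
  + exact: addnC.
  + exact: addnC.
  by rewrite -(code_unzip2 q z); lia.
apply: wp_seq; apply: wp_weaken (wp_colour_loop (i := i) inv1 lti ctx1) _ _ => //.
move=> s2 [rel2 fact]; apply: wp_run => //=.
have rel02 : refines 13 s s2 by apply: refines_trans rel1 rel2 _ _.
split; first by apply: refines_set.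
  by case: rel2 => -> // _ _; rewrite /= s13 mulSn; lia.
by move=> c; apply: relaxed_weaken rel1 (refines_refl 0 _) (fact c).
Qed.

Definition round_time := 2 + ((2 * n) ^ k * (3 + quad_time).+1 + 4).

(** The scan stops where the table begins, which is where the quads end, and [level] contains every
    flagged tuple of length [k]. *)
Lemma wp_round s :
  table_inv s ->
  wp round round_time
    (fun s' => refines 13 s s' /\ forall z c, size z = k ->
                 relaxed z c (cell s) (cell s')) s.
Proof.
move=> inv_s; have [ir _] := inv_s.
apply: wp_seq; apply: wp_run => //; set s0 := run _ _.
have rel0 : refines 13 s s0 by exact: refines_set_reg.
pose I j s1 := [/\ refines 13 s s1, reg s1 13 = rp + j * 4
  & forall i c, i < j -> relaxed (nth [::] level i) c (cell s) (cell s1)].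
rewrite -size_level.
apply: (@wp_weaken _ (size level * (3 + quad_time).+1 + 4) _ (I (size level))) => //.
  apply: wp_while.
  - by split=> //=; rewrite ir // addn0.
  - move=> i s1 lti [rel1 s1_13 fact].
    have inv1 : table_inv s1 by case: rel1 => _ _; apply.
    split; first by have [ir1 _] := inv1; rewrite /= ir1 // s1_13 fbE; lia.
    apply: wp_weaken (wp_quad inv1 lti s1_13) _ _ => // s2 [rel2 s2_13 fact2].
    split=> //; first exact: refines_trans rel1 rel2 _ _.
    move=> i' c; rewrite ltnS leq_eqVlt => /orP [/eqP -> |lti'].
      exact: relaxed_weaken rel1 (refines_refl 0 _) (fact2 c).
    exact: relaxed_weaken (refines_refl 0 _) rel2 (fact i' c lti').
  move=> s1 [rel1 s1_13 _]; have [_ _ /(_ inv_s) [ir1 _]] := rel1.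
  by rewrite /= ir1 // s1_13 fbE; lia.
move=> s1 [rel1 _ fact]; split=> // z c szz.
have zi : z \in level by rewrite mem_level szz.
by rewrite -(nth_index [::] zi); apply: fact; rewrite index_mem.
Qed.

Definition rounds_time := (n + n) * (round_time + 8) + 6.

Lemma wp_rounds s :
  connected_graph e -> proper_colouring e w -> R0 5 = n + n -> table_inv s ->
  (forall v, tab (cell s) (nseq k v) (w v) = 0) ->
  wp (For 12 5 round) rounds_time
    (fun s' => refines 12 s s' /\ complete_upto e w k (tab (cell s')) (n + n)) s.
Proof.
move=> conn prop_w r5 inv_s leaf0.
apply: (@wp_for _ _ _ _ _ (fun i s1 => refines 12 s s1 /\
   complete_upto e w k (tab (cell s1)) i)) => //.
- by have [ir _] := inv_s; rewrite ir.
- by split=> //=; [exact: refines_set_reg | exact: complete0].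
move=> i s1 lti s1i s1n [rel compl].
have inv1 : table_inv s1 by case: rel => _ _; apply.
apply: wp_weaken (wp_round inv1) _ _ => // s2 [rel2 fact].
have [r2 _ _] := rel2; rewrite !r2 //; split=> //.
have rel02 : refines 12 s s2 by apply: refines_trans rel rel2 _ _.
split; first by apply: refines_set.
apply: complete_step compl => //= [v|t a d szt|z x y d szz exy].
- by apply/eqP; rewrite -leqn0 -(leaf0 v); apply: refines_tab rel02.
(* Any flags would do for a recolouring; all positions are put into the first part. *)
- have [] := fact (map (pair true) t) d; first by rewrite size_map.
  by rewrite /unzip2 -map_comp map_id_in.
by have [merged _] := fact z d szz; apply: merged.
Qed.

End Rounds.

(** * Building the list of split tuples *)

(* The quads form a queue, from register 6 to register 7; each quad of one level
   is popped while its extensions by one position are pushed.  The quad of the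
   empty tuple is zero, as is blank memory. *)
Definition setup :=
  Seq (Seq (Assign 4 (Add (Add (Const 4) (Reg 1)) (Reg 3)))
        (Seq (Assign 5 (Add (Reg 1) (Reg 1))) (Assign 6 (Reg 4))))
    (Seq (For 11 1 (Assign 6 (Add (Reg 6) (Reg 1))))
      (Seq (Assign 7 (Add (Reg 6) (Const 4)))
        (Seq (Assign 8 (Reg 2)) (Seq (Assign 9 (Const 0)) (Assign 10 (Const 0)))))).

(** Registers 17 to 20 hold the parent quad, 8 the weight of the new digit and 15 that weight times
    the rank of the new vertex. The first four stores make the child with the position chosen, the
    next four its counterpart. *)
Definition push_children :=
  Seq (Store (Reg 7) (Add (Reg 17) (Reg 15)))
  (Seq (Store (Add (Reg 7) (Const 1)) (Reg 18))
  (Seq (Store (Add (Reg 7) (Const 2)) (Add (Reg 19) (Reg 8)))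
  (Seq (Store (Add (Reg 7) (Const 3)) (Reg 20))
  (Seq (Store (Add (Reg 7) (Const 4)) (Reg 17))
  (Seq (Store (Add (Reg 7) (Const 5)) (Add (Reg 18) (Reg 15)))
  (Seq (Store (Add (Reg 7) (Const 6)) (Reg 19))
  (Seq (Store (Add (Reg 7) (Const 7)) (Add (Reg 20) (Reg 8)))
  (Seq (Assign 7 (Add (Reg 7) (Const 8)))
       (Assign 15 (Add (Reg 15) (Reg 8))))))))))).

Definition expand_front :=
  Seq (Seq (Assign 17 (Fetch (Reg 6)))
      (Seq (Assign 18 (Fetch (Add (Reg 6) (Const 1))))
      (Seq (Assign 19 (Fetch (Add (Reg 6) (Const 2))))
      (Seq (Assign 20 (Fetch (Add (Reg 6) (Const 3)))) (Assign 15 (Const 0))))))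
    (Seq (For 16 1 push_children) (Assign 6 (Add (Reg 6) (Const 4)))).

(** Register 12 counts how often the weight is added to the code of [U], replacing a multiplication;
    14 marks the end of the current level. After a pop, register 15 has reached the weight of the
    following digit. *)
Definition next_level :=
  Seq (Assign 12 (Fetch (Add (Add (Const 4) (Reg 1)) (Reg 11))))
    (Seq (For 13 12 (Assign 9 (Add (Reg 9) (Reg 8))))
      (Seq (Seq (Assign 10 (Add (Reg 10) (Reg 8))) (Assign 14 (Reg 7)))
        (Seq (While (Defs.Sub (Reg 14) (Reg 6)) expand_front)
          (Assign 8 (Reg 15))))).

Section Build.
Variables (V C : finType) (e : rel V) (w : {ffun V -> C}) (U : {set V}) (d0 : C).
Local Notation n := #|V|.
Local Notation q := #|C|.
Local Notation k := #|U|.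
Local Notation inp := (nth 0 (encode e w U d0)).
Implicit Types (s : state) (z : seq (bool * V)) (zs : seq (seq (bool * V))).

Definition constants := [:: 0; n; q; k; 4 + n + k; n + n].

Definition queue zs s :=
  [/\ forall r, 0 < r < 6 -> reg s r = nth 0 constants r,
      input_size U <= reg s 6, reg s 7 = reg s 6 + 4 * size zs,
      forall j, j < input_size U -> cell s j = inp j
    & mem_at (cell s) (reg s 6) (quads q zs)].

Lemma queue_ext zs s s' :
  (forall r, 0 < r < 8 -> reg s' r = reg s r) -> cell s' = cell s ->
  queue zs s -> queue zs s'.
Proof.
move=> rE cE [s_const s6 s7 s_inp s_mem]; rewrite /queue cE !rE //; split=> //.
by move=> r /andP [r0 ltr]; rewrite rE ?s_const ?r0 // (leq_trans ltr).
Qed.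

Lemma mem_at_rcons f b l a v :
  mem_at f b l -> a = b + size l -> mem_at [eta f with a |-> v] b (rcons l v).
Proof.
move=> fl -> i; rewrite size_rcons ltnS leq_eqVlt nth_rcons /= eqn_add2l.
by case: eqP => [->|_] /=; [rewrite ltnn | move=> lti; rewrite lti fl].
Qed.

Lemma quad_cons b v z : quad q ((b, v) :: z) =
  let P := q * n ^ size z in
  [:: nth 0 (quad q z) 0 + b * (rank v * P); nth 0 (quad q z) 1 + ~~ b * (rank v * P);
      nth 0 (quad q z) 2 + b * P; nth 0 (quad q z) 3 + ~~ b * P].
Proof. by rewrite /quad /= !mulnA. Qed.

Definition child_pair v z := [:: (true, v) :: z; (false, v) :: z].

Lemma wp_push_children v z zs s :
  queue zs s -> reg s 8 = q * n ^ size z -> reg s 15 = rank v * reg s 8 ->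
  (forall j, j < 4 -> reg s (17 + j) = nth 0 (quad q z) j) ->
  wp push_children 60
    (fun s' => [/\ queue (zs ++ child_pair v z) s',
                   reg s' 15 = (rank v).+1 * reg s 8
                 & forall r, r != 7 -> r != 15 -> reg s' r = reg s r]) s.
Proof.
move=> [s_const s6 s7 s_inp s_mem] s8 s15 s_quad; apply: wp_run => //.
have [[[s17 s18] s19] s20] := (s_quad 0 isT, s_quad 1 isT, s_quad 2 isT, s_quad 3 isT).
split; last first.
- by move=> r neq7 neq15; rewrite /= (negPf neq7) (negPf neq15).
- by rewrite /= s15 mulSnr.
split=> /=.
- by move=> r /andP [r0 ltr]; rewrite !ifF ?s_const ?r0 //; apply/eqP; lia.
- by [].
- by rewrite size_cat /= s7; lia.
- by move=> j ltj; rewrite !ifF ?s_inp //; apply/eqP; lia.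
have -> : quads q (zs ++ child_pair v z) =
    quads q zs ++ (quad q ((true, v) :: z) ++ quad q ((false, v) :: z)).
  exact: quads_cat.
rewrite !quad_cons -s17 -s18 -s19 -s20 -s8 /= -s15 !mul0n !mul1n !addn0 -!cat_rcons cats0.
have sq := size_quads q zs.
by do 8!(apply: mem_at_rcons; last by rewrite ?size_rcons ?sq; lia).
Qed.

Lemma extend_rcons z vs v : extend z (rcons vs v) = extend z vs ++ child_pair v z.
Proof. by rewrite /extend map_rcons flatten_rcons. Qed.

Lemma take_card : take n (enum V) = enum V.
Proof. by rewrite take_oversize // -cardE. Qed.

Lemma wp_children_loop z zs s :
  queue zs s -> reg s 8 = q * n ^ size z -> reg s 15 = 0 ->
  (forall j, j < 4 -> reg s (17 + j) = nth 0 (quad q z) j) ->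
  wp (For 16 1 push_children) (n * (60 + 8) + 6)
    (fun s' => [/\ queue (zs ++ extend z (enum V)) s',
                   reg s' 15 = n * reg s 8
                 & forall r, r != 7 -> r != 15 -> r != 16 -> reg s' r = reg s r]) s.
Proof.
move=> s_queue s8 s15 s_quad; rewrite -take_card.
pose I i s1 := [/\ queue (zs ++ extend z (take i (enum V))) s1, reg s1 15 = i * reg s 8
  & forall r, r != 7 -> r != 15 -> r != 16 -> reg s1 r = reg s r].
apply: (@wp_for _ _ _ _ _ I) => //.
- by have [s_const _ _ _ _] := s_queue; rewrite s_const.
- split=> [|//|r _ _ neq /=]; last by rewrite (negPf neq).
  by rewrite take0 cats0; apply: queue_ext s_queue => // r ltr /=; rewrite ifF //; apply/eqP; lia.
move=> i s1 lti s1i s1n [q1 s1_15 s1_r].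
have [v vi] := rank_surj lti; rewrite -vi in s1i q1 s1_15 *.
apply: wp_weaken (wp_push_children (v := v) (z := z) q1 _ _ _) _ _ => //.
- by rewrite s1_r.
- by rewrite s1_15 s1_r.
- by move=> j ltj; rewrite s1_r ?s_quad //; lia.
move=> s2 [q2 s2_15 s2_r]; rewrite !s2_r //; split=> //.
split=> [||r neq7 neq15 neq16 /=].
- rewrite take_rank extend_rcons catA.
  by apply: queue_ext q2 => // r ltr /=; rewrite ifF //; apply/eqP; lia.
- by rewrite /= s2_15 s1_r.
by rewrite (negPf neq16) s2_r ?s1_r.
Qed.

Definition pop_time := 20 + (n * (60 + 8) + 6 + 4).

Lemma wp_expand_front z zs s :
  queue (z :: zs) s -> reg s 8 = q * n ^ size z ->
  wp expand_front pop_time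
    (fun s' => [/\ queue (zs ++ extend z (enum V)) s',
                   reg s' 15 = n * reg s 8, reg s' 6 = reg s 6 + 4
                 & forall r, 8 <= r < 15 -> reg s' r = reg s r]) s.
Proof.
move=> s_queue s8; have [s_const s6 s7 s_inp s_mem] := s_queue.
apply: wp_seq; apply: wp_run => //; set s1 := run _ _.
have s_quad j : j < 4 -> cell s (reg s 6 + j) = nth 0 (quad q z) j.
  move=> ltj; rewrite s_mem; first by rewrite nth_cat ltj.
  by rewrite size_quads; apply: leq_trans ltj _; rewrite /= mulnS leq_addr.
have s1_r r : r < 15 -> reg s1 r = reg s r.
  by move=> ltr; rewrite /= !ifF //; apply/eqP; lia.
have q1 : queue (z :: zs) s1.
  by apply: queue_ext s_queue => // r /andP [_ ltr]; rewrite s1_r //; apply: leq_trans ltr _.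
apply: wp_seq; apply: wp_weaken (wp_children_loop (z := z) q1 _ _ _) _ _ => //.
  by case=> [|[|[|[|//]]]] _; rewrite -s_quad //= addn0.
move=> s2 [q2 s2_15 s2_r]; apply: wp_run => //.
have s2_r' r : r < 15 -> r != 7 -> reg s2 r = reg s r.
  by move=> ltr neq; rewrite s2_r ?s1_r //; apply/eqP; lia.
have [s2_const le2 s2_7 s2_inp s2_mem] := q2.
split=> /=.
- split=> /=.
  + by move=> r /andP [r0 ltr]; rewrite ifF ?s2_const ?r0 //; apply/eqP; lia.
  + exact: leq_trans le2 (leq_addr _ _).
  + by rewrite s2_7 /=; lia.
  + exact: s2_inp.
  by move/mem_at_cat: s2_mem => [_].
- by rewrite s2_15 s1_r.
- by rewrite s2_r'.
by move=> r /andP [ler ltr]; rewrite ifF ?s2_r' //; apply/eqP; lia.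
Qed.

Definition level_time :=
  7 + (n * (5 + 8) + 6 + (6 + ((2 * n) ^ k * (3 + pop_time).+1 + 4 + 2))).

Lemma wp_next_level i s :
  0 < n -> i < k -> queue (level V i) s -> reg s 11 = i -> reg s 8 = q * n ^ i ->
  wp next_level level_time
    (fun s' => [/\ queue (level V i.+1) s', reg s' 8 = q * n ^ i.+1,
       reg s' 9 = reg s 9 + inp (4 + n + i) * reg s 8,
       reg s' 10 = reg s 10 + reg s 8 & reg s' 11 = i]) s.
Proof.
move=> n0 lti s_queue s11 s8; have [s_const s6 s7 s_inp s_mem] := s_queue.
apply: wp_seq; apply: wp_run => //; set s1 := run _ _.
have s1_12 : reg s1 12 = inp (4 + n + i).
  have s1n : reg s 1 = n by rewrite s_const.
  by rewrite /= s1n s11 s_inp // /input_size; lia.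
have q1 : queue (level V i) s1.
  by apply: queue_ext s_queue => // r ltr /=; rewrite ifF //; apply/eqP; lia.
pose I j s2 := [/\ queue (level V i) s2, reg s2 9 = reg s 9 + j * reg s 8
  & forall r, r != 9 -> r != 13 -> reg s2 r = reg s1 r].
apply: wp_seq; apply: (@wp_weaken _ (n * (5 + 8) + 6) _ (I (inp (4 + n + i)))) => //.
  have lt_inp : inp (4 + n + i) <= n.
    have [v0 _] : exists v0 : V, rank v0 = 0 by apply: rank_surj.
    by rewrite (input_set _ _ _ v0) // ltnW // rank_lt.
  apply: (@wp_weaken _ (inp (4 + n + i) * (5 + 8) + 6) _ (I (inp (4 + n + i)))) => //; last first.
    by rewrite leq_add2r leq_mul2r lt_inp orbT.
  apply: wp_for => //.
  - split=> [||r neq9 neq13 /=]; last by rewrite (negPf neq13).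
    + by apply: queue_ext q1 => // r ltr /=; rewrite ifF //; apply/eqP; lia.
    + by rewrite /= addn0.
  move=> j s2 ltj s2_13 s2_12 [q2 s2_9 s2_r]; apply: wp_run => //=; split=> //.
  split=> [||r neq9 neq13 /=]; last by rewrite (negPf neq9) (negPf neq13) s2_r.
  - by apply: queue_ext q2 => // r ltr /=; rewrite !ifF //; apply/eqP; lia.
  by rewrite /= s2_9 s2_r // mulSn /=; lia.
move=> s2 [q2 s2_9 s2_r].
apply: wp_seq; apply: wp_run => //; set s3 := run _ _.
have q3 : queue (level V i) s3.
  by apply: queue_ext q2 => // r ltr /=; rewrite !ifF //; apply/eqP; lia.
pose L := level V i.
(* After [j] pops the rest of the level is followed by the children of its first [j] tuples.
   Register 15 is known only after a pop, and [L0] ensures that there is one. *)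
pose J j s4 := [/\ queue (drop j L ++ flatten [seq extend z (enum V) | z <- take j L]) s4,
  reg s3 14 = reg s4 6 + 4 * (size L - j), 0 < j -> reg s4 15 = n * reg s 8
  & forall r, 8 <= r < 15 -> reg s4 r = reg s3 r].
have s3_8 : reg s3 8 = reg s 8 by rewrite /= s2_r.
have L0 : 0 < size L by rewrite size_level expn_gt0 muln_gt0 n0.
apply: wp_seq.
apply: (@wp_weaken _ (size L * (3 + pop_time).+1 + 4) _ (J (size L))).
- apply: wp_while.
  + split=> //; first by rewrite drop0 take0 cats0.
    by have [_ _ s2_7 _ _] := q2; rewrite /= s2_7 subn0.
  + move=> j s4 ltj [q4 s4_6 s4_15 s4_r].
    split; first by rewrite /= s4_r // s4_6; lia.
    rewrite (drop_nth [::] ltj) in q4; set z := nth _ _ _ in q4.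
    have szz : size z = i by apply/eqP; rewrite -mem_level mem_nth.
    have s4_8 : reg s4 8 = q * n ^ size z by rewrite s4_r // s3_8 s8 szz.
    apply: wp_weaken (wp_expand_front q4 s4_8) _ _ => //.
    move=> s5 [q5 s5_15 s5_6 s5_r]; split.
    * by rewrite (take_nth [::] ltj) map_rcons flatten_rcons catA.
    * by rewrite s5_6 s4_6; lia.
    * by move=> _; rewrite s5_15 s4_r // s3_8.
    by move=> r ltr; rewrite s5_r ?s4_r.
  by move=> s4 [_ s4_14 _ s4_r]; rewrite /= s4_r // s4_14 subnn muln0 addn0 subnn.
- rewrite leq_add2r leq_mul2r size_level; apply/orP; right.
  by apply: leq_pexp2l (ltnW lti); rewrite muln_gt0 n0.
move=> s4 [q4 _ s4_15 s4_r]; apply: wp_run => //=.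
rewrite drop_size take_size cat0s in q4.
split.
- by apply: queue_ext q4 => // r ltr /=; rewrite !ifF //; apply/eqP; lia.
- by rewrite s4_15 // s8 expnS mulnCA.
- by rewrite s4_r //= s2_9.
- by rewrite s4_r //= !s2_r.
by rewrite s4_r //= s2_r.
Qed.

End Build.

(** * The whole program *)

Definition fill_table := For 11 8 (Store (Add (Reg 7) (Reg 11)) (Reg 1)).

Definition mark_leaves :=
  For 11 1 (Seq (Store (Add (Reg 12) (Fetch (Add (Const 4) (Reg 11)))) (Const 0))
                (Assign 12 (Add (Reg 12) (Reg 10)))).

Definition general_case :=
  Seq setup (Seq (For 11 3 next_level)
    (Seq (Seq fill_table (Seq (Assign 12 (Reg 7)) mark_leaves))
      (Seq (For 12 5 round)
        (Assign 0 (Fetch (Add (Add (Reg 7) (Reg 9)) (Fetch (Const 3)))))))).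

(** The truncated differences in both directions add up to zero exactly when the target colour, in
    cell 3, is that of the first vertex, in cell 4. *)
Definition single_vertex :=
  If (Add (Defs.Sub (Fetch (Const 3)) (Fetch (Const 4)))
          (Defs.Sub (Fetch (Const 4)) (Fetch (Const 3))))
     (Assign 0 (Const 1)) (Assign 0 (Const 0)).

(** With one vertex there is no edge and the permitted time is constant, which rules out building a
    table whose size grows with the number of colours. *)
Definition flood :=
  Seq (Seq (Assign 1 (Fetch (Const 0)))
        (Seq (Assign 2 (Fetch (Const 1))) (Assign 3 (Fetch (Const 2)))))
    (If (Defs.Sub (Reg 1) (Const 1)) general_case single_vertex).

(** * Correctness of the assembled program *)

Section Correctness.
Variables (V C : finType) (e : rel V) (w : {ffun V -> C}) (U : {set V}) (d0 : C).
Hypothesis conn : connected_graph e.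
Local Notation n := #|V|.
Local Notation q := #|C|.
Local Notation k := #|U|.
Local Notation inp := (nth 0 (encode e w U d0)).
Local Notation target := (rev (enum U)).
Local Notation unit_code := (wsum n q (fun=> 1) (nseq k tt)).
Implicit Types s : state.

Definition setup_time := 12 + (n * (5 + 8) + 6 + 13).

Lemma wp_setup s :
  (forall j, cell s j = inp j) -> reg s 1 = n -> reg s 2 = q -> reg s 3 = k ->
  wp setup setup_time
    (fun s' => [/\ queue e w U d0 (level V 0) s', reg s' 8 = q, reg s' 9 = 0
                 & reg s' 10 = 0]) s.
Proof.
move=> s_inp s1 s2 s3; apply: wp_seq; apply: wp_run => //; set s0 := run _ _.
pose I i t := [/\ forall r, r != 6 -> r != 11 -> reg t r = reg s0 r, cell t = cell s
  & reg t 6 = 4 + n + k + i * n].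
apply: wp_seq; apply: (@wp_weaken _ (n * (5 + 8) + 6) _ (I n)) => //.
  apply: wp_for => //.
  - split=> // [r _ neq /=|]; first by rewrite (negPf neq).
    by rewrite /= s1 s3 mul0n addn0.
  move=> i t lti ti tn [t_r t_c t6]; apply: wp_run => //=; split=> //.
  split=> //= [r neq6 neq11|].
    by rewrite (negPf neq11) (negPf neq6) t_r //= (negPf neq6).
  by rewrite t6 tn mulSnr addnA.
move=> t [t_r t_c t6]; apply: wp_run => //; split; last by [].
- split=> /=.
  + by case=> [|[|[|[|[|[|r]]]]]] //= _; rewrite t_r //= ?s1 ?s2 ?s3.
  + by rewrite t6.
  + by rewrite muln1.
  + by rewrite t_c.
  move=> i lti; rewrite t_c s_inp t6 input_blank.
    by case: i lti => [|[|[|[|]]]].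
  by rewrite /input_size leq_addr.
- by rewrite /= t_r //= s2.
by [].
Qed.

Definition build_time := k * (level_time U + 8) + 6.

Lemma wp_build s :
  0 < n -> queue e w U d0 (level V 0) s -> reg s 8 = q -> reg s 9 = 0 ->
  reg s 10 = 0 ->
  wp (For 11 3 next_level) build_time
    (fun s' => [/\ queue e w U d0 (level V k) s', reg s' 8 = q * n ^ k,
                   reg s' 9 = code q target & reg s' 10 = unit_code]) s.
Proof.
move=> n0 s_queue s8 s9 s10.
pose I i t := [/\ queue e w U d0 (level V i) t, reg t 8 = q * n ^ i,
  reg t 9 = code q (rev (take i (enum U))) & reg t 10 = wsum n q (fun=> 1) (nseq i tt)].
apply: (@wp_weaken _ build_time _ (I k)) => //; last first.
  by move=> t [tq t8 t9 t10]; rewrite take_oversize -?cardE // in t9.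
apply: wp_for => //.
- by have [s_const _ _ _ _] := s_queue; rewrite s_const.
- split=> /=; rewrite ?muln1 ?take0 //.
  by apply: queue_ext s_queue => // r ltr /=; rewrite ifF //; apply/eqP; lia.
move=> i t lti ti tk [t_queue t8 t9 t10].
apply: wp_weaken (wp_next_level n0 lti t_queue ti t8) _ _ => //.
move=> t' [q' t8' t9' t10' t11']; have [t_const _ _ _ _] := q'.
split=> //; first by rewrite t_const.
split=> /=.
- by apply: queue_ext q' => // r ltr /=; rewrite ifF //; apply/eqP; lia.
- exact: t8'.
- have [v0 _] : exists v0 : V, rank v0 = 0 by apply: rank_surj.
  (* The new element becomes the leading digit, hence the reversal; in the end only the set of
     entries matters. *)
  rewrite t9' t9 t8 (input_set _ _ _ v0) // (take_nth v0) -?cardE // rev_rcons.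
  by rewrite /code /= size_rev size_takel // -cardE ltnW.
by rewrite t10' t10 t8 size_nseq mul1n.
Qed.

(** The value [n] is sound everywhere by [reaches_full]; since entries never increase, it also
    bounds the answer. *)
Lemma wp_fill_table s :
  queue e w U d0 (level V k) s -> reg s 8 = q * n ^ k ->
  wp fill_table (q * n ^ k * (5 + 8) + 6)
    (fun s' => table_inv e w U d0 (reg s) s' /\ forall (t : seq V) (d : C), size t = k ->
       tab (reg s) (cell s') t d = n) s.
Proof.
move=> [s_const s6 s7 s_inp s_mem] s8.
pose I i s1 := [/\ forall r, r != 11 -> reg s1 r = reg s r,
  forall j, j < reg s 7 -> cell s1 j = cell s j
  & forall j, j < i -> cell s1 (reg s 7 + j) = n].
apply: (@wp_weaken _ (q * n ^ k * (5 + 8) + 6) _ (I (q * n ^ k))) => //.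
  apply: wp_for => //.
  - by split=> // r neq /=; rewrite (negPf neq).
  move=> i s1 lti s1i s1Z [s1_r s1_low s1_fill]; apply: wp_run => //=; split=> //.
  split=> /= [r neq|j ltj|j].
  - by rewrite (negPf neq) s1_r.
  - by rewrite (s1_r 7) // ifF ?s1_low //; apply/eqP; lia.
  rewrite ltnS leq_eqVlt (s1_r 7) // (s1_r 1) // s1i eqn_add2l; case: eqP => //= _ ltj.
    by rewrite s_const.
  exact: s1_fill.
move=> s1 [s1_r s1_low s1_fill].
have full (t : seq V) (d : C) : size t = k -> tab (reg s) (cell s1) t d = n.
  by move=> szt; apply: s1_fill; rewrite -szt; apply: code_lt.
split=> //; split; first by move=> r ltr; rewrite s1_r //; apply/eqP; lia.
split=> [j ltj|i lti|t d szt].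
- by rewrite s1_low ?s_inp // s7; lia.
- by rewrite s1_low ?s_mem // s7; move: lti; rewrite size_quads; lia.
by rewrite full //; apply: reaches_full.
Qed.

Definition leaves_time := n * (12 + 8) + 6.

Lemma wp_mark_leaves (R0 : nat -> nat) s :
  (forall r, 0 < r < 6 -> R0 r = nth 0 (constants C U) r) -> input_size U <= R0 6 ->
  R0 7 = R0 6 + 4 * size (level V k) -> R0 10 = unit_code ->
  table_inv e w U d0 R0 s -> reg s 12 = R0 7 ->
  (forall (t : seq V) (d : C), size t = k -> tab R0 (cell s) t d = n) ->
  wp mark_leaves leaves_time
    (fun s' => [/\ table_inv e w U d0 R0 s', forall (t : seq V) (d : C), size t = k ->
       tab R0 (cell s') t d <= n & forall v, tab R0 (cell s') (nseq k v) (w v) = 0]) s.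
Proof.
move=> R_const R6 R7 R10 inv_s s12 full.
pose I i s1 := [/\ table_inv e w U d0 R0 s1, reg s1 12 = R0 7 + i * unit_code,
  forall (t : seq V) (d : C), size t = k -> tab R0 (cell s1) t d <= n
  & forall v, rank v < i -> tab R0 (cell s1) (nseq k v) (w v) = 0].
apply: (@wp_weaken _ leaves_time _ (I n)) => //; last first.
  by move=> s' [table_inv' _ le zero]; split=> // v; apply: zero; apply: rank_lt.
have table_inv_set s1 x v : 11 <= x -> table_inv e w U d0 R0 s1 -> table_inv e w U d0 R0 (set_reg s1 x v).
  by move=> lex [ir im]; split=> // r ltr /=; rewrite ifF ?ir //; apply/eqP; lia.
apply: wp_for => //.
- by have [-> // _] := inv_s; rewrite R_const.
- split=> //=; [exact: table_inv_set | by rewrite addn0 | by move=> t d /full ->].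
move=> i s1 lti s1i s1n [inv1 s1_12 le1 zero1].
have [v vi] := rank_surj lti; rewrite -vi in s1i s1_12 zero1 *.
have [ir im] := inv1; have [s1_inp _ _] := im.
have addrE : reg s1 12 + cell s1 (4 + reg s1 11) =
    R0 7 + (code q (nseq k v) + rank (w v)).
  rewrite s1_12 s1i s1_inp ?input_colour ?code_nseq ?addnA //.
  by rewrite /input_size; have := rank_lt v; lia.
apply: wp_run => //; split=> //.
have cellE j : cell (run (Seq (Store (Add (Reg 12) (Fetch (Add (Const 4) (Reg 11))))
    (Const 0)) (Assign 12 (Add (Reg 12) (Reg 10)))) s1) j =
    if j == R0 7 + (code q (nseq k v) + rank (w v)) then 0 else cell s1 j.
  by rewrite /= addrE.
split.
- do 2!(apply: (table_inv_set _ _ _ _ _) => //); split; first exact: ir.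
  have [R1 [R2 R4]] : R0 1 = n /\ R0 2 = q /\ R0 4 = 4 + n + k by rewrite !R_const.
  rewrite /= addrE; apply: (memory_inv_update R1 R2 R4 R6 R7 im); first exact: size_nseq.
  exact: reaches_const.
- by rewrite /= s1_12 ir // R10 mulSnr addnA.
- move=> t d szt; rewrite /tab cellE; case: eqP => // _; exact: le1.
move=> v'; rewrite ltnS leq_eqVlt /tab cellE => /orP [/eqP /rank_inj ->|ltv].
  by rewrite eqxx.
by case: eqP => // _; apply: zero1.
Qed.

(** The program scans the whole adjacency matrix and its time is bounded without [#|edges e|]; this
    allows the factor to be inserted. *)
Lemma edges_gt0 : 1 < n -> 0 < #|edges e|.
Proof.
case/card_gt1P=> u [v [_ _ neq]]; have [_ /(_ u v)] := conn.
case/connectP=> -[|x p] /=; first by move=> _ eqv; rewrite eqv eqxx in neq.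
case/andP=> eux _ _; apply/card_gt0P; exists [set u; x].
by apply/imsetP; exists (u, x); rewrite // inE.
Qed.

Hypotheses (sym_e : symmetric e) (proper_w : proper_colouring e w).

Definition general_time :=
  setup_time + (build_time + (q * n ^ k * (5 + 8) + 6 + (2 + leaves_time) +
    (rounds_time C U + 8))).

Lemma wp_general_case s :
  (forall j, cell s j = inp j) -> reg s 1 = n -> reg s 2 = q -> reg s 3 = k ->
  wp general_case general_time (fun s' => min_moves e U w d0 (reg s' 0)) s.
Proof.
move=> s_inp s1 s2 s3; have [n0 _] := conn.
apply: wp_seq; apply: wp_weaken (wp_setup s_inp s1 s2 s3) _ _ => // t0 [q0 t0_8 t0_9 t0_10].
apply: wp_seq; apply: wp_weaken (wp_build n0 q0 t0_8 t0_9 t0_10) _ _ => //.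
move=> t1 [q1 t1_8 t1_9 t1_10].
have [R_const R6 R7 _ _] := q1.
apply: wp_seq; apply: wp_seq; apply: wp_weaken (wp_fill_table q1 t1_8) _ _ => //.
move=> t2 [inv2 full2]; apply: wp_seq; apply: wp_run => //.
have inv2' : table_inv e w U d0 (reg t1) (run (Assign 12 (Reg 7)) t2).
  by have [ir im] := inv2; split=> // r ltr; rewrite /= ifF ?ir //; apply/eqP; lia.
have t2_12 : reg (run (Assign 12 (Reg 7)) t2) 12 = reg t1 7.
  by have [ir _] := inv2; rewrite /= ir.
apply: wp_weaken (wp_mark_leaves R_const R6 R7 t1_10 inv2' t2_12 full2) _ _ => //.
move=> t3 [inv3 le3 zero3].
have [r1 [r2 [r4 r5]]] : reg t1 1 = n /\ reg t1 2 = q /\ reg t1 4 = 4 + n + k /\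
    reg t1 5 = n + n by rewrite !R_const.
apply: wp_seq; apply: wp_weaken (wp_rounds r1 r2 r4 R6 R7 conn proper_w r5 inv3 zero3) _ _ => //.
move=> t4 [rel4 compl4]; apply: wp_run => //.
have [_ _ /(_ inv3) [ir im]] := rel4; have [t4_inp _ sound4] := im.
have -> : reg (run (Assign 0 (Fetch (Add (Add (Reg 7) (Reg 9)) (Fetch (Const 3))))) t4) 0
    = tab (reg t1) (cell t4) target d0.
  by rewrite /= !ir // (t4_inp 3) // /tab t1_9 addnA.
have szt : size target = k by rewrite size_rev cardE.
apply: (complete_min_moves sym_e szt _ (sound4 _ _ szt) _ compl4).
  by move=> v; rewrite mem_rev mem_enum.
exact: leq_trans (refines_tab _ _ rel4) (le3 _ _ szt).
Qed.

Lemma wp_single_vertex s :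
  n = 1 -> (forall j, cell s j = inp j) ->
  wp single_vertex 20 (fun s' => min_moves e U w d0 (reg s' 0)) s.
Proof.
move=> n1 s_inp.
have [v rv] : exists v : V, rank v = 0 by apply: rank_surj; rewrite n1.
have allv u : u = v.
  by apply: rank_inj; rewrite rv; apply/eqP; rewrite -leqn0 -ltnS -n1 rank_lt.
have cv : inp 4 = rank (w v) by rewrite -(input_colour e w U d0) rv.
have lnk w' : linked e U w' d0 <-> w' v = d0.
  split=> [[u [<- _]]|vd]; first by rewrite (allv u).
  by exists v; split=> //; apply/subsetP=> u _; rewrite (allv u) mono_component_refl.
apply: wp_run => //=; rewrite !s_inp cv -[inp 3]/(rank d0).
have [eqd|neqd] := eqVneq (w v) d0.
  rewrite eqd subnn /=; split; last by [].
  by exists [::]; split=> //; apply/lnk.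
have -> : rank d0 - rank (w v) + (rank (w v) - rank d0) != 0.
  apply: contraNneq neqd => eq0; apply/eqP/rank_inj; lia.
split=> /=.
  exists [:: (v, d0)]; split=> //; apply/lnk; rewrite /= ffunE /=.
  by rewrite mono_component_refl.
by case=> //= /lnk vd; rewrite vd eqxx in neqd.
Qed.

End Correctness.

(** * Arithmetic of the running time *)

Section Time.
Variables (V C : finType) (U : {set V}).
Local Notation n := #|V|.
Local Notation q := #|C|.
Local Notation k := #|U|.
Hypotheses (n_gt1 : 1 < n) (q_gt0 : 0 < q).

(** For each colour, all pairs of vertices are tried for a merge and all colours for a recolouring;
    [n * n * q * q] dominates both contributions. *)
Lemma quad_time_le : quad_time V C <= 300 * (n * n * q * q).
Proof.
have n0 : 0 < n := ltnW n_gt1.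
have source_le : source_time V <= 80 * n by rewrite /source_time /merge_time; lia.
have colour_le : colour_time V C <= 200 * (n * n * q).
  have nn0 : 0 < n * n by rewrite muln_gt0 n0.
  have := leq_pmull q nn0; have := leq_pmulr (n * n) q_gt0; have := leq_pmulr n n0.
  by have := leq_mul (leqnn n) source_le; rewrite /colour_time; lia.
have nnq0 : 0 < n * n * q by rewrite !muln_gt0 n0.
have := leq_pmull q nnq0; have := leq_mul (leqnn q) colour_le.
by rewrite /quad_time; lia.
Qed.

(** The [n + n] rounds supply the third factor [n], the scan of the quads the factor
    [(2 * n) ^ k]. *)
Lemma rounds_time_le :
  rounds_time C U <= 700 * ((2 * n) ^ k * (n * n * n * q * q)).
Proof.
have n0 : 0 < n := ltnW n_gt1.
have a0 : 0 < (2 * n) ^ k by rewrite expn_gt0 muln_gt0 n0.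
have M0 : 0 < n * n * q * q by rewrite !muln_gt0 n0 q_gt0.
have aM0 : 0 < (2 * n) ^ k * (n * n * q * q) by rewrite muln_gt0 a0.
have round_le : round_time C U <= 320 * ((2 * n) ^ k * (n * n * q * q)).
  rewrite /round_time; move: quad_time_le a0 aM0; set a := (2 * n) ^ k => quad_le a0 aM0.
  by have := leq_pmulr a M0; have := leq_mul (leqnn a) quad_le; lia.
rewrite /rounds_time; move: round_le aM0; set a := (2 * n) ^ k => round_le aM0.
by have := leq_pmulr n aM0; have := leq_mul (leqnn n) round_le; lia.
Qed.

Lemma build_time_le : build_time U <= 170 * ((2 * n) ^ k * (n * n)).
Proof.
have n0 : 0 < n := ltnW n_gt1.
have a0 : 0 < (2 * n) ^ k by rewrite expn_gt0 muln_gt0 n0.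
have level_le : level_time U <= 150 * ((2 * n) ^ k * n).
  rewrite /level_time /pop_time; move: a0; set a := (2 * n) ^ k => a0.
  by have := leq_pmulr a n0; have := leq_pmull n a0; lia.
have kn : k <= n by apply: max_card.
rewrite /build_time; move: a0 level_le; set a := (2 * n) ^ k => a0 level_le.
have level8_le : level_time U + 8 <= 150 * (a * n) + 8 by lia.
have := leq_mul kn level8_le; have := leq_pmulr n n0.
by have := leq_pmull (n * n) a0; lia.
Qed.

Lemma general_time_le :
  general_time C U <= 2000 * (n ^ (k + 3) * q ^ 2 * 2 ^ k).
Proof.
have n0 : 0 < n := ltnW n_gt1.
have a0 : 0 < (2 * n) ^ k by rewrite expn_gt0 muln_gt0 n0.
have -> : n ^ (k + 3) * q ^ 2 * 2 ^ k = (2 * n) ^ k * (n * n * n * q * q).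
  by rewrite expnD expnMn [n ^ 3]expnSr -!mulnn; lia.
have le_fill : n ^ k <= (2 * n) ^ k by rewrite expnMn leq_pmull // expn_gt0.
move: rounds_time_le build_time_le a0 le_fill; rewrite /general_time.
set a := (2 * n) ^ k; set b := n ^ k => rounds_le build_le a0 le_fill.
have nn0 : 0 < n * n by rewrite muln_gt0 n0.
have n3_gt0 : 0 < n * n * n by rewrite muln_gt0 nn0.
have nq0 : 0 < n * q * q by rewrite !muln_gt0 n0 q_gt0.
have le_build : a * (n * n) <= a * (n * n * n * q * q).
  have -> : n * n * n * q * q = n * n * (n * q * q) by lia.
  by rewrite leq_mul2l leq_pmulr ?orbT.
have n3q0 : 0 < n * n * n * q by rewrite muln_gt0 n3_gt0.
have qb_le : q * b <= a * (n * n * n * q * q).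
  by rewrite mulnC; apply: leq_mul => //; apply: leq_pmull.
have n_le : n <= a * (n * n).
  by apply: leq_trans (leq_pmulr n n0) _; apply: leq_pmull.
by rewrite /setup_time /leaves_time; lia.
Qed.

End Time.

Theorem theorem5p1 :
  exists (P : prog) (K : nat),
  forall (V C : finType) (e : rel V) (w : {ffun V -> C}) (U : {set V})
         (n k : nat) (d : C),
    symmetric e -> irreflexive e -> connected_graph e ->
    proper_colouring e w ->
    #|V| = n -> #|U| = k ->
    exists m : nat,
      min_moves e U w d m /\
      (* the successor matters only when n = 1, where there is no edge *)
      computes_within P (encode e w U d) m
        (K * (n ^ (k + 3) * #|edges e| * #|C| ^ 2 * 2 ^ k).+1).
Proof.
exists flood, 2000 => V C e w U n k d sym_e _ conn proper_w <- <-.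
set X := _ * 2 ^ _.
pose s0 := State (fun=> 0) (nth 0 (encode e w U d)).
suff [t [s [ex let_ mm]]] : wp flood (2000 * X.+1)
    (fun s => min_moves e U w d (reg s 0)) s0.
  by exists (reg s 0); split=> //; exists t, s.
have [n0 _] := conn.
(* Loading three registers costs 9; this and the cost 4 of the test are paid from the 2000 that the
   successor adds. *)
have -> : 2000 * X.+1 = 9 + (2000 * X.+1 - 9) by lia.
apply: wp_seq; apply: wp_run => //; set s1 := run _ _.
have [n_gt1|n_le1] := ltnP 1 #|V|.
  apply: (@wp_weaken _ (4 + general_time C U) _ (fun s => min_moves e U w d (reg s 0))) => //.
    apply: wp_if => [_|]; first exact: wp_general_case.
    by move/eqP; rewrite /= subn_eq0 leqNgt n_gt1.
  have q0 : 0 < #|C| by apply/card_gt0P; exists d.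
  have le := general_time_le U n_gt1 q0; have E0 := edges_gt0 conn n_gt1.
  suff : general_time C U <= 2000 * X by lia.
  apply: leq_trans le _; rewrite leq_mul2l /X /=.
  rewrite -!mulnA leq_mul2l; apply/orP; right.
  by rewrite leq_pmull.
have n1 : #|V| = 1 by apply/eqP; rewrite eqn_leq n_le1.
apply: (@wp_weaken _ (4 + 20) _ (fun s => min_moves e U w d (reg s 0))) => //; last by lia.
apply: wp_if => [|_]; first by rewrite /= n1.
exact: wp_single_vertex.
Qed.
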